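(* Let $G$ be a $2$-connected plane graph with maximum face degree $\Delta^*(G)$ and at least four faces. Then either $G$ is a subdivision of a simple $3$-connected plane graph, or $G$ contains a separating cycle of length $n$ with $n \leq \Delta^*(G)$.
   Context: Plane graphs may have multiple edges but no loops; a simple graph has no multiple edges. The degree of a face is the number of vertices incident with it, and $\Delta^*(G)$ is the maximum face degree of $G$. A subdivision of an edge $uv$ replaces it by a path $u,w,v$ through a new vertex $w$; a subdivision of a graph is obtained by a sequence of edge subdivisions. For a cycle $C$ in a plane graph $G$, $\mathrm{int}_G(C)$ and $\mathrm{ext}_G(C)$ denote the sets of vertices and edges of $G$ lying (strictly) inside and outside $C$, respectively; $C$ is a separating cycle if both $\mathrm{int}_G(C)$ and $\mathrm{ext}_G(C)$ are nonempty. *)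

(* Defs.v *)
From mathcomp Require Import all_boot fingroup perm.

Set Implicit Arguments.
Unset Strict Implicit.
Unset Printing Implicit Defensive.

(* A connected plane graph with at least one edge, multiple edges allowed and
   loops forbidden, given combinatorially: every edge is a pair of opposite
   darts d, rev d; the dart d leaves the vertex tail d; and rot d is the next
   dart around tail d, in a fixed orientation of the plane.  The faces are
   then the orbits of d |-> rot (rev d), the orbit of d being the face on one
   fixed side of d, and the embedding is in the sphere exactly when Euler's
   formula V + F = E + 2 holds.  The dart pg_outer marks the unbounded face,
   which turns the sphere into the plane. *)
Record plane_graph := PlaneGraph {
  vertex : finType;
  dart : finType;
  tail : dart -> vertex;
  rev : {perm dart};
  rot : {perm dart};
  pg_outer : dart;
  revK : involutive rev;
  pg_loopless : forall d, tail (rev d) != tail d;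
  pg_rotP : forall d d', (tail d == tail d') = (d' \in porbit rot d);
  pg_connected : forall u v : vertex,
    connect [rel x y | [exists d, (tail d == x) && (tail (rev d) == y)]] u v;
  pg_euler : #|vertex| + #|porbits (rev * rot)%g| = #|porbits rev| + 2
}.

Section PlaneGraph.
Variable G : plane_graph.
Implicit Types (d : dart G) (u v : vertex G) (c : seq (dart G)).

Definition head d : vertex G := tail (rev G d).

Definition adj : rel (vertex G) :=
  [rel u v | [exists d, (tail d == u) && (head d == v)]].

Definition simple_graph : Prop :=
  forall d d', tail d = tail d' -> head d = head d' -> d = d'.

Definition k_connected (k : nat) : Prop :=
  k < #|vertex G| /\
  forall S : {set vertex G}, #|S| < k ->
  forall u v, u \notin S -> v \notin S ->
    connect [rel x y | [&& x \notin S, y \notin S & adj x y]] u v.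

(* (s * t)%g maps d to t (s d). *)
Definition face : {perm dart G} := (rev G * rot G)%g.

Definition faces : {set {set dart G}} := porbits face.

Definition face_degree (F : {set dart G}) : nat := #|[set tail d | d in F]|.

Definition max_face_degree : nat := \max_(F in faces) face_degree F.

(* A cycle is listed by its darts, in the order of traversal, so that its
   length is size c.  The last condition excludes d, rev d as a cycle of length
   2, but two parallel edges do form one. *)
Definition is_cycle c : bool :=
  [&& c != [::], path.cycle (fun d d' => head d == tail d') c,
      uniq (map (@tail G) c) & all (fun d => rev G d \notin c) c].

Definition on_cycle_vertex c v : bool := v \in map (@tail G) c.

Definition on_cycle_edge c d : bool := (d \in c) || (rev G d \in c).

(* The regions of the plane minus the cycle c are obtained by glueing the faces
   of G along the edges not in c: outside c d says that the face of d
   lies in the same region as the unbounded face. *)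
Definition glue c : rel (dart G) :=
  [rel x y | (y == face x) || ~~ on_cycle_edge c x && (y == rev G x)].

Definition outside c d : bool := connect (glue c) (pg_outer G) d.

(* An edge not in c has both its sides in the region that contains it, and all
   faces around a vertex not in c are in the region that contains this vertex.
   Sets of edges are given as sets of darts, closed under rev. *)
Definition ext_vertices c : {set vertex G} :=
  [set v | ~~ on_cycle_vertex c v && [exists d, (tail d == v) && outside c d]].
Definition ext_edges c : {set dart G} :=
  [set d | ~~ on_cycle_edge c d && outside c d].
Definition int_vertices c : {set vertex G} :=
  [set v | ~~ on_cycle_vertex c v
           && [exists d, (tail d == v) && ~~ outside c d]].
Definition int_edges c : {set dart G} :=
  [set d | ~~ on_cycle_edge c d && ~~ outside c d].

Definition separating_cycle c : Prop :=
  [/\ is_cycle c,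
      int_vertices c != set0 \/ int_edges c != set0
    & ext_vertices c != set0 \/ ext_edges c != set0].

End PlaneGraph.

(* Isomorphism of plane graphs: rotations and unbounded face are preserved. *)
Definition plane_iso (H G : plane_graph) : Prop :=
  exists (i : dart H -> dart G) (j : vertex H -> vertex G),
    [/\ bijective i, bijective j,
        forall d, tail (i d) = j (tail d)
      & (forall d, rev G (i d) = i (rev H d)) /\
        (forall d, rot G (i d) = i (rot H d)) /\
        i (pg_outer H) \in porbit (face G) (pg_outer G)].

(* G is, up to isomorphism, obtained from H by subdividing the edge e = uv:
   w is the new vertex, a and b are the darts from w to u and from w to v, and
   the darts i e, i (rev e) are now the darts from u to w and from v to w. *)
Definition edge_subdivision (H G : plane_graph) : Prop :=
  exists (e : dart H) (i : dart H -> dart G) (j : vertex H -> vertex G)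
         (w : vertex G) (a b : dart G),
    [/\ [/\ injective i, a \notin codom i, b \notin codom i, a != b
          & forall d, d \in codom i \/ d = a \/ d = b],
        [/\ injective j, w \notin codom j
          & forall v, v \in codom j \/ v = w],
        [/\ forall d, tail (i d) = j (tail d), tail a = w & tail b = w],
        [/\ rev G (i e) = a, rev G (i (rev H e)) = b
          & forall d, d != e -> d != rev H e -> rev G (i d) = i (rev H d)]
      & [/\ forall d, rot G (i d) = i (rot H d), rot G a = b, rot G b = a
          & i (pg_outer H) \in porbit (face G) (pg_outer G)]].

Inductive is_subdivision (H : plane_graph) : plane_graph -> Prop :=
| subdivision_iso G : plane_iso H G -> is_subdivision H G
| subdivision_step K G :
    is_subdivision H K -> edge_subdivision K G -> is_subdivision H G.

(* Main.v *)
(* Call two faces pinched if they share two vertices u, v such that each of the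
   four boundary arcs P1, Q1 (of the first face) and P2, Q2 (of the second)
   between u and v has an edge that does not lie on the other face.  Two faces
   traverse their common vertices in opposite cyclic orders, so that P1 + P2 and
   Q1 + Q2 are cycles; each separates the two faces, and an unshared edge lies on
   either side.  Their lengths add up to the sum of the two face degrees, hence
   one of them is at most the maximum face degree.

   If no two faces are pinched, suppress the vertices of degree 2 (this neither
   creates pinched faces nor loops, as there are more than two faces).  When the
   minimum degree is 3, a pair of parallel edges or a 2-vertex cut yields pinched
   faces: they are found at the corners of u where the rotation crosses from one
   side of the separation to the other.

   The topology enters through 2-colorings: by Euler's formula, every even edge
   set is the boundary of a set of faces, and dually every edge set that is even
   on each face is a vertex cut. *)
From mathcomp Require Import all_boot fingroup perm.
From mathcomp Require Import ssralg zmodp matrix mxalgebra zify.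
Require Import Defs.

Set Implicit Arguments.
Unset Strict Implicit.
Unset Printing Implicit Defensive.

(** * Cyclic intervals in the orbits of a permutation *)

Section Arc.
Variables (T : finType) (s : {perm T}).
Implicit Types x y z : T.

Lemma mem_porbit_fconnect x y : (y \in porbit s x) = fconnect s x y.
Proof.
apply/porbitP/idP => [[i ->]|/iter_findex <-]; first by rewrite permX fconnect_iter.
by exists (findex s x y); rewrite permX.
Qed.

Lemma porbit_step x y : (s y \in porbit s x) = (y \in porbit s x).
Proof. by rewrite -!eq_porbit_mem -(porbit_perm s 1 y) expg1. Qed.

Lemma porbit_same x y : y \in porbit s x -> porbit s y = porbit s x.
Proof. by move=> yx; apply/eqP; rewrite eq_porbit_mem. Qed.

Lemma porbit_trans x y z :
  y \in porbit s x -> z \in porbit s y -> z \in porbit s x.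
Proof. by rewrite !mem_porbit_fconnect; apply: connect_trans. Qed.

Lemma porbit_ind (P : T -> Prop) x y :
  P x -> (forall z, P z -> P (s z)) -> y \in porbit s x -> P y.
Proof.
move=> Px PS /porbitP [i ->]; rewrite permX.
by elim: i => //= i; apply: PS.
Qed.

Lemma porbit_invariant (A : Type) (f : T -> A) x y :
  (forall z, f (s z) = f z) -> y \in porbit s x -> f y = f x.
Proof. by move=> fs; apply: (@porbit_ind (fun y => f y = f x)) => // z <-. Qed.

(** Otherwise [P] would propagate along the whole orbit. *)
Lemma perm_last_before (P : pred T) x z :
  P x -> z \in porbit s x -> ~~ P z ->
  exists2 d, d \in porbit s x & P d && ~~ P (s d).
Proof.
move=> Px zx nPz; have [d|none] := pickP [pred d | [&& d \in porbit s x, P d & ~~ P (s d)]].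
  by case/andP=> dx Pd; exists d.
suff/andP[_ Pz]: (z \in porbit s x) && P z by rewrite Pz in nPz.
apply: (@porbit_ind (fun z => (z \in porbit s x) && P z) _ _ _ _ zx).
  by rewrite porbit_id.
move=> d /andP[dx Pd]; rewrite porbit_step dx /=.
by have:= none d; rewrite /= dx Pd /= => /negbFE.
Qed.

(* The half-open cyclic interval [x, y) of the s-orbit of x. *)
Definition arc x y z := fconnect s x z && (findex s x z < findex s x y).

Lemma arc_porbit x y z : arc x y z -> z \in porbit s x.
Proof. by rewrite mem_porbit_fconnect => /andP[]. Qed.

Lemma arc_start x y : x != y -> arc x y x.
Proof. by move=> xy; rewrite /arc connect0 findex0 lt0n findex_eq0. Qed.

Lemma arc_end x y : arc x y y = false.
Proof. by rewrite /arc ltnn andbF. Qed.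

Lemma mem_traject_arc x y z :
  y \in porbit s x -> (z \in traject s x (findex s x y)) = arc x y z.
Proof.
rewrite mem_porbit_fconnect => xy; apply/trajectP/andP => [[i lt_i ->]|[xz lt_z]].
  by rewrite fconnect_iter findex_iter // (ltn_trans lt_i) // findex_max.
by exists (findex s x z); rewrite ?iter_findex.
Qed.

(** Membership switches on at [x], off at [y], and nowhere else; in this form it can be summed
    modulo 2 around a vertex. *)
Lemma arc_boundary x y z : x != y -> y \in porbit s x ->
  arc x y (s z) (+) arc x y z = (s z == x) (+) (s z == y).
Proof.
move=> xDy; rewrite mem_porbit_fconnect /arc => xy.
have -> : fconnect s x (s z) = fconnect s x z.
  by rewrite -!mem_porbit_fconnect porbit_step.
have [xz|nxz] := boolP (fconnect s x z); last first.
  have E w : fconnect s x w -> (s z == w) = false.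
    move=> xw; apply: contraNF nxz => /eqP zw; move: xw.
    by rewrite -zw -!mem_porbit_fconnect porbit_step.
  by rewrite !E.
have:= iter_findex xz; have:= findex_max xz.
set i := findex s x z => lt_i Ei; rewrite -Ei -iterS /=.
set n := findex s x y; have lt_n : n < fingraph.order s x := findex_max xy.
have n_gt0 : 0 < n by rewrite lt0n findex_eq0.
have [lt_i1|] := ltnP i.+1 (fingraph.order s x).
  rewrite -!iterS findex_iter //.
  have -> : (iter i.+1 s x == x) = false.
    apply/eqP => E; have:= findex_iter lt_i1; by rewrite E findex0.
  have -> : (iter i.+1 s x == y) = (i.+1 == n).
    apply/eqP/eqP => [E|->]; last exact: (iter_findex xy).
    by rewrite /n -E findex_iter.
  by rewrite /= ltn_neqAle eq_sym; case: (ltngtP n i.+1) => //; lia.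
(* Here [z] is the last element of the orbit counted from [x], so that [s z] wraps around to [x]. *)
rewrite leq_eqVlt ltnNge lt_i orbF => /eqP ord.
have -> : s (iter i s x) = x.
  by rewrite -iterS -ord iter_order //; apply: perm_inj.
rewrite findex0 n_gt0 eqxx (negbTE xDy) /=.
by rewrite ltnNge -ltnS -ord lt_n.
Qed.

Lemma arc_step x y z : x != y -> y \in porbit s x ->
  arc x y z -> s z != y -> arc x y (s z).
Proof.
move=> xDy xy az nsz; have:= arc_boundary z xDy xy.
rewrite az (negbTE nsz) addbF.
by case: eqP => [-> _|_]; [apply: arc_start | case: arc].
Qed.

Lemma arc_step_start x y z : x != y -> y \in porbit s x ->
  arc x y z -> s z != x.
Proof.
move=> xDy xy az; apply/eqP => szx; have:= arc_boundary z xDy xy.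
by rewrite az szx arc_start // eqxx (negbTE xDy).
Qed.

Lemma arc_ind (P : T -> Prop) x y z : x != y -> y \in porbit s x ->
  P x -> (forall w, arc x y w -> s w != y -> P w -> P (s w)) ->
  arc x y z -> P z.
Proof.
move=> xDy xy Px PS /andP[xz]; rewrite -{2}(iter_findex xz).
have lt_n : findex s x y < fingraph.order s x.
  by apply: findex_max; rewrite -mem_porbit_fconnect.
elim: (findex s x z) => [|i IHi] //= lt_i; apply: PS.
- by rewrite /arc fconnect_iter findex_iter ?(ltnW lt_i) //; lia.
- apply/eqP => E; have := ltn_trans lt_i lt_n => lt_i'.
  by have:= findex_iter lt_i'; rewrite /= E; lia.
- by apply: IHi; apply: ltnW.
Qed.

Lemma arc_partition x y z : x != y -> y \in porbit s x ->
  arc x y z (+) arc y x z = (z \in porbit s x).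
Proof.
move=> xDy xy; have yDx : y != x by rewrite eq_sym.
have yx : x \in porbit s y by rewrite porbit_sym.
have inv w : arc x y (s w) (+) arc y x (s w) = arc x y w (+) arc y x w.
  have:= arc_boundary w xDy xy; have:= arc_boundary w yDx yx.
  by do 4!case: arc; do 2!case: eqP.
have [zx|nzx] := boolP (z \in porbit s x).
  by rewrite (porbit_invariant inv zx) arc_start // arc_end.
apply: contraNF nzx; case a1: (arc x y z); first by rewrite (arc_porbit a1).
by move=> /= /arc_porbit; apply: porbit_trans.
Qed.

Lemma arc_exclusive x y z : x != y -> y \in porbit s x ->
  arc x y z -> ~~ arc y x z.
Proof.
move=> xDy xy az; have:= arc_partition z xDy xy.
by rewrite az (arc_porbit az); case: arc.
Qed.

Lemma uniq_traject_arc x y :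
  y \in porbit s x -> uniq (traject s x (findex s x y)).
Proof.
rewrite mem_porbit_fconnect => xy; have:= orbit_uniq s x.
have:= findex_max xy; rewrite /orbit; move: (findex s x y) => n lt_n.
by rewrite -(subnKC (ltnW lt_n)) trajectD cat_uniq => /andP[].
Qed.

Lemma size_arcs x y : x != y -> y \in porbit s x ->
  findex s x y + findex s y x = #|porbit s x|.
Proof.
move=> xDy xy; have yDx : y != x by rewrite eq_sym.
have yx : x \in porbit s y by rewrite porbit_sym.
have uc : uniq (traject s x (findex s x y) ++ traject s y (findex s y x)).
  rewrite cat_uniq !uniq_traject_arc // andbT; apply/hasPn => z.
  by rewrite !mem_traject_arc // => az; apply: arc_exclusive az.
have := card_uniqP uc; rewrite size_cat !size_traject => <-.
apply: eq_card => z.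
rewrite mem_cat !mem_traject_arc // -(arc_partition z xDy xy).
by case a1: arc => //=; rewrite (negbTE (arc_exclusive xDy xy a1)).
Qed.

End Arc.

(** * Linear algebra over the two-element field: on the sphere, even edge sets are boundaries *)

Section ExactComplex.
Import GRing.Theory.
Local Open Scope ring_scope.

(** Exactness of a complex at its middle term: the row space of [A] lies in the kernel of [B], and
    the rank bound forces equality. *)
Lemma row_factor (F : fieldType) (m n p : nat) (A : 'M[F]_(m, n))
    (B : 'M[F]_(n, p)) (r : 'rV[F]_n) :
  A *m B = 0 -> (n <= \rank A + \rank B)%N -> r *m B = 0 ->
  exists y, r = y *m A.
Proof.
move=> AB0 rk rB0; have sAK : (A <= kermx B)%MS by apply/sub_kermxP.
suff sKA : (kermx B <= A)%MS.
  by apply/submxP; apply: submx_trans sKA; apply/sub_kermxP.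
by rewrite -(geq_leqif (mxrank_leqif_sup sAK)) mxrank_ker; lia.
Qed.

(** The left kernel lies in the line spanned by the constant row, so its dimension is at most 1. *)
Lemma rank_ker_const (F : fieldType) (m n : nat) (A : 'M[F]_(m, n)) :
  (forall r : 'rV_m, r *m A = 0 -> forall i j, r 0 i = r 0 j) ->
  (m <= (\rank A).+1)%N.
Proof.
move=> constA; have: (\rank (kermx A) <= 1)%N.
  apply: leq_trans (rank_leq_row (const_mx 1 : 'rV[F]_m)).
  apply: mxrankS; apply/row_subP => k.
  (* For [m = 0] there is no index 0 to read the constant from. *)
  case: m A constA k => [|m] A constA k; first by case: k.
  have rA : row k (kermx A) *m A = 0 by rewrite -row_mul mulmx_ker row0.
  apply/submxP; exists (const_mx (row k (kermx A) 0 0)).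
  apply/rowP => j; rewrite [RHS]mxE big_ord1 !mxE mulr1.
  by have:= constA _ rA j 0; rewrite !mxE.
by rewrite mxrank_ker; lia.
Qed.

Section OrbitIndex.
Variables (T : finType) (s : {perm T}).

Lemma porbit_in_porbits x : porbit s x \in porbits s.
Proof. exact: imset_f. Qed.

Definition orbit_index x : 'I_#|porbits s| :=
  enum_rank_in (porbit_in_porbits x) (porbit s x).

Lemma orbit_indexE x y : (orbit_index x == orbit_index y) = (x \in porbit s y).
Proof.
rewrite -(inj_eq enum_val_inj) !enum_rankK_in ?porbit_in_porbits //.
exact: eq_porbit_mem.
Qed.

Lemma orbit_index_step x : orbit_index (s x) = orbit_index x.
Proof. by apply/eqP; rewrite orbit_indexE porbit_step porbit_id. Qed.

Lemma orbit_index_surj i : exists x, orbit_index x == i.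
Proof.
have /imsetP [x _ Ex] := enum_valP i; exists x.
by rewrite -(inj_eq enum_val_inj) enum_rankK_in ?porbit_in_porbits // Ex.
Qed.

Definition orbit_repr i := xchoose (orbit_index_surj i).

Lemma orbit_reprK : cancel orbit_repr orbit_index.
Proof. by move=> i; apply/eqP; apply: (xchooseP (orbit_index_surj i)). Qed.

End OrbitIndex.

Section Bicolor.
Variables (T : finType) (e a b : {perm T}).
Hypothesis eK : involutive e.
Hypothesis eD : forall d, e d != d.
Hypothesis bE : forall d, b d = a (e d).
Hypothesis transitive : forall P : pred T,
  (forall d, P d -> P (e d)) -> (forall d, P d -> P (a d)) ->
  forall x y, P x -> P y.
Hypothesis euler : (#|porbits a| + #|porbits b| = #|porbits e| + 2)%N.

Let ie := @orbit_index T e.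

Let sum_edge (f : T -> bool) d :
  \sum_(d' | ie d' == ie d) f d' = f d + f (e d).
Proof.
have E d' : (ie d' == ie d) = (d' == d) || (d' == e d).
  rewrite /ie orbit_indexE; apply/idP/orP => [|[]/eqP->].
  - apply: (@porbit_ind T e (fun z => z == d \/ z == e d)); first by left.
    by move=> z [/eqP->|/eqP->]; [right | left; rewrite eK].
  - exact: porbit_id.
  - by rewrite porbit_step porbit_id.
rewrite (eq_bigl _ _ E) (bigD1 d) ?eqxx //=.
rewrite (bigD1 (e d)) ?eqxx ?orbT ?eD //= big1 ?addr0 // => i.
by case: eqP => //= _; case: eqP.
Qed.

(** Addition in [bool] is exclusive or, so an edge with both darts in one orbit gets entry 0
    there. *)
Let incidence (c : {perm T}) : 'M[bool]_(#|porbits e|, #|porbits c|) :=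
  \matrix_(i, j) \sum_(d | ie d == i) (orbit_index c d == j).

(** The transposed matrix is the coboundary map on labellings of the orbits. *)
Let mul_incidence (c : {perm T}) (r : 'rV[bool]_#|porbits c|) d :
  (r *m (incidence c)^T) 0 (ie d) =
  r 0 (orbit_index c d) + r 0 (orbit_index c (e d)).
Proof.
rewrite mxE.
under eq_bigr => k _ do rewrite !mxE sum_edge mulrDr.
rewrite big_split /=; congr (_ + _).
  rewrite (bigD1 (orbit_index c d)) //= eqxx mulr1 big1 ?addr0 // => i.
  by rewrite eq_sym => /negbTE ->; rewrite mulr0.
rewrite (bigD1 (orbit_index c (e d))) //= eqxx mulr1 big1 ?addr0 // => i.
by rewrite eq_sym => /negbTE ->; rewrite mulr0.
Qed.

Let addbb_eq (x y : bool) : x + y = 0 -> y = x.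
Proof. by case: x; case: y. Qed.

(** A row in the kernel of the coboundary has equal labels at both ends of each edge, hence is
    constant by connectedness. *)
Let rank_incidence (c : {perm T}) :
  (forall P : pred T, (forall d, P d -> P (e d)) ->
     (forall d, P d -> P (c d)) -> forall x y, P x -> P y) ->
  (#|porbits c| <= (\rank (incidence c)).+1)%N.
Proof.
move=> tr; rewrite -mxrank_tr; apply: rank_ker_const => r r0 i j.
rewrite -(orbit_reprK i) -(orbit_reprK j); apply/eqP.
move: (orbit_repr i) (orbit_repr j) => x y.
apply: (tr (fun z => r 0 (orbit_index c z) == r 0 (orbit_index c y)) _ _ y).
- move=> d /eqP <-; apply/eqP; apply: addbb_eq.
  by rewrite -mul_incidence r0 mxE.
- by move=> d; rewrite orbit_index_step.
- exact: eqxx.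
Qed.

(** A face boundary has no boundary: after reindexing by [b], the term of [b d = a (e d)] cancels
    that of [e d], which is in the same [a]-orbit. *)
Let incidence_mul0 : (incidence b)^T *m incidence a = 0.
Proof.
apply/matrixP => i k; rewrite !mxE.
transitivity (\sum_d (orbit_index b d == i) *
   (((orbit_index a d == k) : bool) + (orbit_index a (e d) == k)) : bool).
  rewrite [RHS](partition_big ie predT) //=; apply: eq_bigr => j _.
  rewrite !mxE big_distrl /=; apply: eq_bigr => d /eqP <-.
  by rewrite sum_edge.
under eq_bigr => d _ do rewrite mulrDr.
rewrite big_split /= (reindex_inj (@perm_inj _ b)) /=.
rewrite -big_split big1 //= => d _.
by rewrite orbit_index_step bE orbit_index_step; case: (_ * _).
Qed.

(* Over the two-element field, with a-, e- and b-orbits as vertices, edges and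
   faces, Euler's formula is the exactness of the chain complex
   faces -> edges -> vertices: every even edge set bounds a set of faces. *)
Lemma bicolor (f : T -> bool) :
  (forall d, f (e d) = f d) ->
  (forall x, \sum_(d in porbit a x) f d = 0) ->
  exists y : T -> bool,
    (forall d, y (b d) = y d) /\ (forall d, y d + y (e d) = f d).
Proof.
move=> fe f0.
pose r : 'rV[bool]_#|porbits e| := \row_i f (orbit_repr i).
have rE d : r 0 (ie d) = f d.
  rewrite mxE; apply: (@porbit_invariant T e _ f) => //.
  by rewrite -orbit_indexE orbit_reprK.
have r0 : r *m incidence a = 0.
  apply/rowP => k; rewrite !mxE -(orbit_reprK k).
  rewrite -[RHS](f0 (orbit_repr k)) [RHS]big_mkcond /=.
  rewrite [RHS](partition_big ie predT) //=.
  apply: eq_bigr => j _.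
  rewrite !mxE big_distrr /=; apply: eq_bigr => d /eqP Ej.
  rewrite orbit_indexE -(rE d) Ej mxE.
  by case: (_ \in _); rewrite ?mulr1 ?mulr0.
(* Each rank is at least the number of orbits minus one, and by Euler's formula these bounds add up
   to the number of edges. *)
have rk : (#|porbits e| <= \rank (incidence b)^T + \rank (incidence a))%N.
  have rka : (#|porbits a| <= (\rank (incidence a)).+1)%N.
    exact: rank_incidence.
  have rkb : (#|porbits b| <= (\rank (incidence b)^T).+1)%N.
    rewrite mxrank_tr; apply: rank_incidence => P Pe Pb; apply: transitive => //.
    by move=> d Pd; rewrite -[d]eK -bE; apply: Pb; apply: Pe.
  by move: euler rka rkb; lia.
have [y ry] := row_factor incidence_mul0 rk r0.
exists (fun d => y 0 (orbit_index b d)); split => d.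
  by rewrite orbit_index_step.
by rewrite -mul_incidence -ry rE.
Qed.

End Bicolor.
End ExactComplex.

(** * Arcs as edge sets modulo 2, and colorings carried around a vertex *)

Section ArcColoring.
Import GRing.Theory.
Local Open Scope ring_scope.
Variables (T : finType) (e a b : {perm T}).
Hypothesis eK : involutive e.
Hypothesis bE : forall d, b d = a (e d).

(** Taken modulo 2: an edge with both darts on the arc does not count. *)
Definition arc_edge x y d := arc b x y d (+) arc b x y (e d).

Lemma arc_edge_sym x y d : arc_edge x y (e d) = arc_edge x y d.
Proof. by rewrite /arc_edge eK addbC. Qed.

(** An arc is a walk, which modulo 2 has odd degree only at its two ends. Once the first sum is
    shifted by [a], the relation [a d = b (e d)] combines both sums into [arc_boundary] at [e d]. *)
Lemma arc_edge_parity x y w : x != y -> y \in porbit b x ->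
  \sum_(d in porbit a w) (arc_edge x y d : bool) =
  (x \in porbit a w) (+) (y \in porbit a w).
Proof.
move=> xDy xy.
have shift (g : T -> bool) :
    \sum_(d in porbit a w) g d = \sum_(d in porbit a w) g (a d).
  rewrite (reindex_inj (@perm_inj _ a)) /=.
  by apply: eq_bigl => d; rewrite porbit_step.
have pick1 z :
    \sum_(d in porbit a w) (d == z : bool) = (z \in porbit a w) :> bool.
  rewrite big_mkcond (bigD1 z) //= eqxx big1 ?addr0 => [|d /negbTE->].
    by case: (_ \in _).
  by case: (_ \in _).
transitivity (\sum_(d in porbit a w) (arc b x y d : bool)
              + \sum_(d in porbit a w) (arc b x y (e d) : bool)).
  by rewrite -big_split.
rewrite shift -big_split /=.
transitivity (\sum_(d in porbit a w) ((a d == x) + (a d == y) : bool)).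
  apply: eq_bigr => d _.
  by have:= arc_boundary (e d) xDy xy; rewrite bE eK.
rewrite big_split /= -(shift (fun d => d == x)) -(shift (fun d => d == y)).
by rewrite !pick1.
Qed.

(** Since [a d] has the color of [e d], the color changes during the rotation only where an edge
    separates two colors, and none does strictly between [d1] and [d2]. *)
Lemma coloring_rotate (A : Type) (g : T -> A) d1 d2 :
  (forall d, g (b d) = g d) -> d2 \in porbit a d1 -> d1 != d2 ->
  (forall d, d \in porbit a d1 -> d != d1 -> d != d2 -> g (e d) = g d) ->
  g (e d1) = g d2.
Proof.
move=> gb d21 d1D2 ge.
have ga d : g (a d) = g (e d) by rewrite -[a d](congr1 a (eK d)) -bE gb.
(* The predecessor of [d2] is the last dart of the arc; the color past it is that of [d2]. *)
have az : arc a d1 d2 ((a^-1)%g d2).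
  have:= arc_boundary ((a^-1)%g d2) d1D2 d21.
  by rewrite permKV arc_end eqxx eq_sym (negbTE d1D2).
suff: g (e ((a^-1)%g d2)) = g (e d1) by move<-; rewrite -ga permKV.
apply: (arc_ind (P := fun z => g (e z) = g (e d1)) d1D2 d21) az => //.
move=> w aw awD Pw; rewrite -Pw -(ga w); apply: ge => //.
- by rewrite porbit_step (arc_porbit aw).
- exact: arc_step_start aw.
Qed.

Lemma coloring_constant (A : eqType) (g : T -> A) d1 d2 :
  (forall d, g (b d) = g d) -> d2 \in porbit a d1 ->
  (forall d, d \in porbit a d1 -> g (e d) = g d) -> g d2 = g d1.
Proof.
move=> gb d21 ge.
suff /andP[_ /eqP//]: (d2 \in porbit a d1) && (g d2 == g d1).
apply: (porbit_ind (P := fun z => (z \in porbit a d1) && (g z == g d1))) d21.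
  by rewrite porbit_id eqxx.
move=> z /andP[zd /eqP <-]; rewrite porbit_step zd -(ge z zd) -(gb (e z)) bE eK.
exact: eqxx.
Qed.

End ArcColoring.

(** * Plane graphs in terms of darts, with the colorings that Euler's formula provides *)

Section PlaneGraphTheory.
Variable G : plane_graph.
Implicit Types (d x y : dart G) (u v w : vertex G).

Lemma faceE d : face G d = rot G (rev G d).
Proof. by rewrite permM. Qed.

Lemma rotE d : rot G d = face G (rev G d).
Proof. by rewrite faceE revK. Qed.

Lemma eq_tail d d' : (tail d == tail d') = (d' \in porbit (rot G) d).
Proof. exact: pg_rotP. Qed.

Lemma tail_rot d : tail (rot G d) = tail d.
Proof. by apply/eqP; rewrite eq_sym eq_tail porbit_step porbit_id. Qed.

Lemma tail_rev d : tail (rev G d) = head d.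
Proof. by []. Qed.

Lemma head_rev d : head (rev G d) = tail d.
Proof. by rewrite /head revK. Qed.

Lemma tail_face d : tail (face G d) = head d.
Proof. by rewrite faceE tail_rot. Qed.

Lemma revD d : rev G d != d.
Proof. by apply: contra_neq (pg_loopless d) => ->. Qed.

Lemma adjP u v :
  reflect (exists2 d, tail d = u & head d = v) (adj u v).
Proof.
apply: (iffP existsP) => [[d /andP[/eqP <- /eqP <-]]|[d <- <-]]; exists d => //.
by rewrite !eqxx.
Qed.

Lemma adj_sym u v : adj u v = adj v u.
Proof.
by apply/adjP/adjP => -[d <- <-]; exists (rev G d); rewrite ?tail_rev ?head_rev.
Qed.

Lemma connected_ind (P : vertex G -> Prop) u v :
  (forall d, P (tail d) -> P (head d)) -> P u -> P v.
Proof.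
move=> Pd Pu; have /connectP [p] := pg_connected u v.
elim: p u Pu => [|w p IHp] u Pu /=; first by move=> _ ->.
move=> /andP[/existsP[d /andP[/eqP du /eqP dw]] pw] vE.
by apply: IHp pw vE; rewrite -dw; apply: Pd; rewrite du.
Qed.

Lemma dart_ind (P : pred (dart G)) x y :
  (forall d, P d -> P (rev G d)) -> (forall d, P d -> P (rot G d)) ->
  P x -> P y.
Proof.
move=> Prev Prot Px.
have Pt d d' : tail d = tail d' -> P d -> P d'.
  move/eqP; rewrite eq_tail => dd' Pd.
  exact: (porbit_ind (P := fun z => P z)) dd'.
suff: [exists d, (tail d == tail y) && P d].
  by case/existsP => d /andP[/eqP dy]; apply: Pt.
apply: (@connected_ind (fun v => [exists d, (tail d == v) && P d]) (tail x)).
  move=> d /existsP[d' /andP[/eqP dd' Pd']]; apply/existsP; exists (rev G d).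
  by rewrite eqxx; apply/Prev/(Pt d').
by apply/existsP; exists x; rewrite eqxx.
Qed.

Lemma vertex_dart v : exists d, tail d = v.
Proof.
suff: [exists d, tail d == v] by case/existsP => d /eqP; exists d.
apply: (@connected_ind (fun v => [exists d, tail d == v]) (tail (pg_outer G))).
  by move=> d _; apply/existsP; exists (rev G d).
by apply/existsP; exists (pg_outer G).
Qed.

(** Every vertex has a dart, as the graph is connected and [pg_outer] exists; so vertices correspond
    to orbits of [rot]. *)
Lemma card_vertex : #|vertex G| = #|porbits (rot G)|.
Proof.
have ex v : exists d, tail d == v.
  by have [d <-] := vertex_dart v; exists d.
pose f v := porbit (rot G) (xchoose (ex v)).
have fE d : f (tail d) = porbit (rot G) d.
  apply/eqP; rewrite /f eq_porbit_mem -eq_tail eq_sym.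
  exact: (xchooseP (ex (tail d))).
have f_inj : injective f.
  move=> u v; have [d <-] := vertex_dart u; have [d' <-] := vertex_dart v.
  by rewrite !fE => /eqP; rewrite eq_porbit_mem -eq_tail => /eqP.
rewrite -(card_imset _ f_inj); apply: eq_card => O.
apply/imsetP/imsetP => [[v _ ->]|[d _ ->]]; last by exists (tail d); rewrite ?fE.
by exists (xchoose (ex v)).
Qed.

Lemma euler_rot : #|porbits (rot G)| + #|porbits (face G)| = #|porbits (rev G)| + 2.
Proof. by rewrite -card_vertex; apply: pg_euler. Qed.

(** A combinatorial Jordan curve theorem: [y] is a set of faces bounded by the even edge set [f]. *)
Lemma face_coloring (f : dart G -> bool) :
  (forall d, f (rev G d) = f d) ->
  (forall x, \sum_(d in porbit (rot G) x) f d = 0)%R ->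
  exists y : dart G -> bool,
    (forall d, y (face G d) = y d) /\ (forall d, y d (+) y (rev G d) = f d).
Proof.
apply: bicolor; [exact: revK | exact: revD | exact: faceE | | exact: euler_rot].
by move=> P Prev Prot x y; apply: dart_ind.
Qed.

(** The planar dual, obtained by exchanging [rot] and [face]: [y] is one side of the vertex cut
    [f]. *)
Lemma vertex_coloring (f : dart G -> bool) :
  (forall d, f (rev G d) = f d) ->
  (forall x, \sum_(d in porbit (face G) x) f d = 0)%R ->
  exists y : dart G -> bool,
    (forall d, y (rot G d) = y d) /\ (forall d, y d (+) y (rev G d) = f d).
Proof.
apply: bicolor; [exact: revK | exact: revD | exact: rotE | |].
  move=> P Prev Pface x y; apply: dart_ind => // d Pd.
  by rewrite rotE; apply/Pface/Prev.
by rewrite addnC; apply: euler_rot.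
Qed.


End PlaneGraphTheory.

(** * From 2-connectedness to faces that never repeat a vertex *)

Lemma connect_ind (T : finType) (e : rel T) (P : T -> Prop) x y :
  (forall z t, e z t -> P z -> P t) -> P x -> connect e x y -> P y.
Proof.
move=> Pe Px /connectP [p]; elim: p x Px => [|z p IHp] x Px /=; first by move=> _ ->.
by move=> /andP[xz pz]; apply: IHp pz; apply: Pe Px.
Qed.

(** The form in which 2-connectedness enters all later arguments; it is inherited when a vertex of
    degree 2 is suppressed. *)
Definition simple_faces (G : plane_graph) : Prop :=
  forall d d' : dart G,
    d' \in porbit (face G) d -> tail d = tail d' -> d = d'.

(* Two visits of a face to the vertex tail x split the darts around tail x into
   two intervals; a curve inside the face joins the two ends of an interval, so
   the interval is cut off from the rest of the graph minus tail x. *)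
Lemma k_connected2_simple_faces (G : plane_graph) :
  k_connected G 2 -> simple_faces G.
Proof.
case=> _ conn2 x x' x'f x't; apply/eqP; apply/negPn/negP => xDx'.
have x'r : x' \in porbit (rot G) x by rewrite -eq_tail; apply/eqP.
(* The interval of darts from [x] to [x'] around [tail x] has both ends on one face, so it is even
   on each face and forms a vertex cut. This cut puts [head x] and [head x'] on different sides. *)
have [||z [zr zE]] := @vertex_coloring G (arc_edge (rev G) (rot G) x x').
- exact: (arc_edge_sym _ (@revK G)).
- move=> w; rewrite (arc_edge_parity (@revK G) (@rotE G)) //.
  by rewrite ![_ \in porbit _ w]porbit_sym (porbit_same x'f) addbb.
have arcD d : tail d != tail x -> arc (rot G) x x' d = false.
  by apply: contra_neqF => /arc_porbit; rewrite -eq_tail => /eqP.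
have zt d d' : tail d = tail d' -> z d' = z d.
  by move/eqP; rewrite eq_tail; apply: porbit_invariant zr.
have nS d : tail d = tail x -> head d \notin [set tail x].
  by move=> <-; rewrite inE pg_loopless.
have zx : z (rev G x) = ~~ z x.
  have:= zE x; rewrite /arc_edge arc_start // arcD ?pg_loopless //.
  by case: (z x); case: (z (rev G x)).
have zx' : z (rev G x') = z x.
  have:= zE x'; rewrite /arc_edge arc_end arcD; last by rewrite x't pg_loopless.
  by rewrite (zt _ _ x't); case: (z x); case: (z (rev G x')).
have cS : #|[set tail x]| < 2 by rewrite cards1.
have:= conn2 _ cS _ _ (nS x erefl) (nS x' (esym x't)).
(* No edge avoiding [tail x] is in the cut, so the side of [head x] spreads to [head x']. *)
move/(connect_ind (P := fun v => forall d, tail d = v -> z d = ~~ z x)).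
suff H v v' : [&& v \notin [set tail x], v' \notin [set tail x] & adj v v'] ->
    (forall d, tail d = v -> z d = ~~ z x) ->
    forall d, tail d = v' -> z d = ~~ z x.
  move=> /(_ H) K; have: z (rev G x') = ~~ z x.
    by apply: K => // d dx; rewrite -zx; apply: zt.
  by rewrite zx'; case: (z x).
rewrite !inE => /and3P[vw v'w /adjP[d dv dv']] Pv d' d'v'.
rewrite (zt (rev G d)); last by rewrite tail_rev dv' d'v'.
rewrite -(Pv d dv); have:= zE d.
rewrite /arc_edge !arcD ?tail_rev ?dv ?dv' //.
by case: (z d); case: (z (rev G d)).
Qed.

Lemma connect_sym_step (T : finType) (e : rel T) :
  (forall x y, e x y -> connect e y x) -> connect_sym e.
Proof.
move=> eV; suff H x y : connect e x y -> connect e y x.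
  by move=> x y; apply/idP/idP; apply: H.
move=> xy; apply: (connect_ind (P := fun z => connect e z x)) xy => // z t zt.
exact/connect_trans/eV.
Qed.

(** * Two faces with two common vertices *)

Section FacePairs.
Variable G : plane_graph.
Hypothesis sf : simple_faces G.
Implicit Types d x y z p q : dart G.

Lemma faces_gt1_other d :
  1 < #|faces G| -> exists d', d' \notin porbit (face G) d.
Proof.
move=> F1; apply/existsP; rewrite -negb_forall; apply: contraL F1 => /forallP all1.
rewrite -leqNgt -(cards1 (porbit (face G) d)); apply: subset_leq_card.
apply/subsetP => O /imsetP [x _ ->]; rewrite inE; apply/eqP.
by apply: porbit_same; apply: all1.
Qed.

(** A simple face with [d] and [rev d] on it would turn back at both ends of the edge, which would
    then be the whole graph, with a single face. *)
Lemma rev_notin_face d : 1 < #|faces G| -> rev G d \notin porbit (face G) d.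
Proof.
move=> F1; apply/negP => rd.
have E1 : face G d = rev G d.
  apply: sf; last by rewrite tail_face.
  by rewrite (porbit_same (x := d)) ?porbit_step ?porbit_id.
have E2 : face G (rev G d) = d.
  apply: sf; last by rewrite tail_face head_rev.
  by rewrite porbit_sym porbit_step.
have [d'] := faces_gt1_other d F1; apply/negP; rewrite negbK.
have all2 : (d' == d) || (d' == rev G d).
  apply: (@dart_ind _ (fun z => (z == d) || (z == rev G d)) d).
  - by move=> z /orP[]/eqP->; rewrite ?revK eqxx ?orbT.
  - by move=> z /orP[]/eqP->; rewrite ?rotE ?revK ?E1 ?E2 eqxx ?orbT.
  - by rewrite eqxx.
by case/orP: all2 => /eqP->; rewrite ?porbit_id.
Qed.

Hypothesis F1 : 1 < #|faces G|.

Lemma arc_tail_start x y d : arc (face G) x y d -> tail d = tail x -> d = x.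
Proof. by move=> /arc_porbit dx /esym E; apply/esym/sf. Qed.

(** The face enters [tail z] along [rev d] and continues with [rot d], while [z] is its only dart
    leaving that vertex. *)
Lemma arc_head_rot x y z d : arc (face G) x y (rev G d) ->
  z \in porbit (face G) x -> tail d = tail z -> rot G d = z.
Proof.
move=> /arc_porbit dx zx E; apply: sf; last by rewrite tail_rot.
by rewrite rotE; apply: porbit_trans zx; rewrite porbit_sym porbit_step.
Qed.

Lemma arc_tail_end x y d : y \in porbit (face G) x ->
  arc (face G) x y d -> tail d != tail y.
Proof.
move=> yx ad; apply/eqP => E; have:= ad; suff -> : d = y by rewrite arc_end.
apply: sf => //; apply: porbit_trans yx.
by rewrite porbit_sym (arc_porbit ad).
Qed.

Lemma arc_head_start x y d : x != y -> y \in porbit (face G) x ->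
  arc (face G) x y (rev G d) -> tail d != tail x.
Proof.
move=> xDy yx ad; apply/eqP => E; have:= arc_step_start xDy yx ad.
by rewrite -rotE (arc_head_rot (z := x) ad) ?porbit_id // eqxx.
Qed.

(** The darts along which two distinct faces leave two common vertices. They name the boundary arcs:
    P1 runs from [x1] to [y1], Q1 from [y1] to [x1], P2 from [x2] to [y2], Q2 from [y2] to [x2]. *)
Definition two_faces x1 y1 x2 y2 :=
  [/\ tail x1 = tail x2, tail y1 = tail y2, tail x1 != tail y1
    & [/\ y1 \in porbit (face G) x1, y2 \in porbit (face G) x2
        & x2 \notin porbit (face G) x1]].

Lemma two_faces_sym x1 y1 x2 y2 :
  two_faces x1 y1 x2 y2 -> two_faces x2 y2 x1 y1.
Proof.
case=> Ex Ey D [o1 o2 o12]; split=> //; first by rewrite -Ex -Ey.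
by split=> //; rewrite porbit_sym.
Qed.

Lemma two_faces_swap x1 y1 x2 y2 :
  two_faces x1 y1 x2 y2 -> two_faces y1 x1 y2 x2.
Proof.
case=> Ex Ey D [o1 o2 o12]; split=> //; first by rewrite eq_sym.
split; rewrite 1?porbit_sym //.
by rewrite porbit_sym (porbit_same o1) porbit_sym (porbit_same o2) porbit_sym.
Qed.

Lemma two_faces_neq x1 y1 x2 y2 : two_faces x1 y1 x2 y2 -> x1 != y1.
Proof. by case=> _ _ D _; apply: contra_neq D => ->. Qed.

Lemma two_faces_disjoint x1 y1 x2 y2 d :
  two_faces x1 y1 x2 y2 -> d \in porbit (face G) x1 ->
  d \in porbit (face G) x2 -> False.
Proof.
case=> _ _ _ [_ _ /negP o12] d1 d2; apply: o12; apply: porbit_trans d1 _.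
by rewrite porbit_sym.
Qed.

(** P1 and P2 have the same ends, so their sum is even and bounds a set of faces. At [tail x1] only
    the edges of [x1] and [x2] belong to it: rotating from [x1] to [x2] gives the far side of [x1]
    the color of the second face, and crossing [x1] changes the color. *)
Lemma two_faces_coloring x1 y1 x2 y2 : two_faces x1 y1 x2 y2 ->
  exists y : dart G -> bool,
    [/\ forall d, y (face G d) = y d,
        forall d, y d (+) y (rev G d) =
          arc_edge (rev G) (face G) x1 y1 d (+) arc_edge (rev G) (face G) x2 y2 d
      & y x1 != y x2].
Proof.
move=> tf; have tf' := two_faces_sym tf.
have D1 := two_faces_neq tf; have D2 := two_faces_neq tf'.
have [Ex Ey D [o1 o2 o12]] := tf.
have [||y [yf yE]] := @face_coloring G (fun d =>
  arc_edge (rev G) (face G) x1 y1 d (+) arc_edge (rev G) (face G) x2 y2 d).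
- by move=> d; rewrite !(arc_edge_sym _ (@revK G)).
- move=> w; rewrite big_split /=.
  rewrite !(arc_edge_parity (@revK G) (@faceE G)) //.
  by rewrite ![_ \in porbit _ w]porbit_sym -!eq_tail Ex Ey; apply: addbb.
exists y; split=> //.
have off x1' y1' x2' y2' d : two_faces x1' y1' x2' y2' -> tail d = tail x1' ->
    d != x1' -> arc_edge (rev G) (face G) x1' y1' d = false.
  move=> tf1 Ed dDx; have [_ _ _ [o1' _ _]] := tf1.
  rewrite /arc_edge; case: (boolP (arc _ _ _ d)) => [ad|_].
    by rewrite (arc_tail_start ad Ed) eqxx in dDx.
  apply/negP => /(arc_head_start (two_faces_neq tf1) o1').
  by rewrite Ed eqxx.
have -> : y x2 = y (rev G x1).
  apply/esym; apply: (coloring_rotate (@revK G) (@faceE G)) => //.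
  - by rewrite -eq_tail Ex.
  - by apply: contraNneq o12 => <-; rewrite porbit_id.
  - move=> d; rewrite -eq_tail => /eqP Ed dD1 dD2; have:= yE d.
    rewrite (off _ _ _ _ _ tf) // (off _ _ _ _ _ tf') -?Ex //.
    by case: (y d); case: (y _).
have:= yE x1; rewrite (off _ _ _ _ _ tf') //; last first.
  by apply: contraNneq o12 => <-; rewrite porbit_id.
rewrite /arc_edge arc_start //; case: (boolP (arc _ _ _ (rev G x1))).
  by move/arc_porbit; rewrite (negbTE (rev_notin_face _ F1)).
by case: (y x1); case: (y _).
Qed.

(* Two faces meet their common vertices in opposite cyclic orders. *)
Lemma two_faces_order x1 y1 x2 y2 z1 z2 : two_faces x1 y1 x2 y2 ->
  arc (face G) x1 y1 z1 -> arc (face G) x2 y2 z2 -> z1 != x1 ->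
  tail z1 != tail z2.
Proof.
move=> tf a1 a2 z1D; apply/eqP => Ez.
have [Ex Ey D [o1 o2 o12]] := tf.
have tfz : two_faces x1 z1 x2 z2.
  split=> //; first by apply: contra_neq z1D => /esym/(arc_tail_start a1).
  by split=> //; apply: arc_porbit; [apply: a1 | apply: a2].
(* Neither of the arcs ending at [z1] and [z2] reaches the vertex [tail y1], so this coloring is
   constant around it, although both faces pass there. *)
have [y [yf yE yD]] := two_faces_coloring tfz.
have off u v z d : u != v -> v \in porbit (face G) u -> z != u ->
    arc (face G) u v z -> tail d = tail v ->
    arc_edge (rev G) (face G) u z d = false.
  move=> uDv vu zDu az Ed.
  have nv : arc (face G) u z v = false.
    by move: az; rewrite /arc => /andP[_ lt1]; apply/negP => /andP[_]; lia.
  have zu := arc_porbit az; have uDz : u != z by rewrite eq_sym.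
  rewrite /arc_edge; case: (boolP (arc _ _ _ d)) => [ad|_] /=.
    suff E : d = v by rewrite E nv in ad.
    apply: sf => //; apply: porbit_trans vu.
    by rewrite porbit_sym (arc_porbit ad).
  apply/negP => ad; have E := arc_head_rot ad vu Ed.
  have := arc_step uDz zu ad; rewrite -rotE E nv => /(_ _) H.
  by apply: notF; apply: H; apply/eqP => vz; rewrite vz arc_end in az.
have D1 := two_faces_neq tf; have D2 := two_faces_neq (two_faces_sym tf).
have z2D : z2 != x2.
  by apply: contraNneq (two_faces_neq tfz) => E; rewrite (arc_tail_start a1) // Ez E.
suff E : y y2 = y y1.
  move/eqP: yD; apply.
  by rewrite -(porbit_invariant yf o1) -(porbit_invariant yf o2).
apply: (coloring_constant (@revK G) (@faceE G)) => //.
  by rewrite -eq_tail Ey.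
move=> d; rewrite -eq_tail => /eqP Ed; have:= yE d.
rewrite (off _ _ _ _ D1 o1) // (off _ _ _ _ D2 o2) -?Ey //.
by case: (y d); case: (y _).
Qed.

(** P1 and P2 meet only in their ends: a common inner vertex would contradict [two_faces_order].
    Tails on P1 miss the last vertex, heads on P2 the first. *)
Lemma two_faces_tail_head x1 y1 x2 y2 p q : two_faces x1 y1 x2 y2 ->
  arc (face G) x1 y1 q -> arc (face G) x2 y2 p -> tail q != head p.
Proof.
move=> tf aq ap; have tf' := two_faces_sym tf; have D2 := two_faces_neq tf'.
have [Ex Ey D [o1 o2 o12]] := tf.
rewrite -tail_face; have [->|nfy] := eqVneq (face G p) y2.
  by rewrite -Ey; apply: arc_tail_end aq.
have nfx := arc_step_start D2 o2 ap.
by rewrite eq_sym; apply: two_faces_order tf' (arc_step D2 o2 ap nfy) aq nfx.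
Qed.

(** A walk along the far side of P1: the rotation goes from [x1] to [x2] at the start and from
    [face w] to [rev w] at each inner vertex, and meets no other edge of P1 or P2. *)
Lemma two_faces_side (A : Type) (g : dart G -> A) x1 y1 x2 y2 d :
  two_faces x1 y1 x2 y2 ->
  (forall d, g (face G d) = g d) ->
  (forall d, ~~ arc (face G) x1 y1 d -> ~~ arc (face G) x1 y1 (rev G d) ->
     ~~ arc (face G) x2 y2 d -> ~~ arc (face G) x2 y2 (rev G d) ->
     g (rev G d) = g d) ->
  arc (face G) x1 y1 d -> g (rev G d) = g x2.
Proof.
move=> tf gf ge; have tf' := two_faces_sym tf.
have D1 := two_faces_neq tf; have D2 := two_faces_neq tf'.
have [Ex Ey D [o1 o2 o12]] := tf.
apply: (arc_ind (P := fun d => g (rev G d) = g x2)) => //.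
  apply: (coloring_rotate (@revK G) (@faceE G)) => //.
  - by rewrite -eq_tail Ex.
  - by apply: contraNneq o12 => <-; rewrite porbit_id.
  - move=> z; rewrite -eq_tail => /eqP Ez zD1 zD2; apply: ge.
    + by apply: contra_neqN zD1 => az; apply: arc_tail_start az _.
    + by apply: contra_eqN Ez => /(arc_head_start D1 o1); rewrite eq_sym.
    + by apply: contra_neqN zD2 => az; apply: arc_tail_start az _; rewrite -Ex.
    + by move: Ez; rewrite Ex => Ez; apply: contra_eqN Ez => /(arc_head_start D2 o2); rewrite eq_sym.
move=> w aw fwD <-; have afw := arc_step D1 o1 aw fwD.
have fwo := arc_porbit afw; have fwx := arc_step_start D1 o1 aw.
apply: (coloring_rotate (@revK G) (@faceE G)) => //.
- by rewrite -eq_tail tail_face.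
- apply: contraNneq (rev_notin_face w F1) => <-.
  by rewrite porbit_step porbit_id.
move=> z; rewrite -eq_tail => /eqP Ez zD1 zD2; apply: ge.
- apply: contra_neqN zD1 => az; apply: sf => //.
  by apply: porbit_trans fwo; rewrite porbit_sym (arc_porbit az).
- apply: contra_neqN zD2 => az; apply: (@perm_inj _ (rot G)).
  by rewrite (arc_head_rot az fwo) // rotE revK.
- apply: contra_eqN Ez => az; exact: two_faces_order tf afw az fwx.
- apply: contra_eqN Ez => az; rewrite -(head_rev z).
  exact: two_faces_tail_head tf afw az.
Qed.

End FacePairs.

(** * The cycle formed by one arc of each face, and why it separates *)

Section Pinch.
Variable G : plane_graph.
Hypothesis sf : simple_faces G.
Hypothesis F1 : 1 < #|faces G|.
Implicit Types d x y z p q : dart G.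

Definition face_walk x y := traject (face G) x (findex (face G) x y).

(** The cycle P1 + P2, with P2 traversed backwards. *)
Definition lens x1 y1 x2 y2 :=
  face_walk x1 y1 ++ map (rev G) (seq.rev (face_walk x2 y2)).

Lemma mem_lens x1 y1 x2 y2 d : two_faces x1 y1 x2 y2 ->
  (d \in lens x1 y1 x2 y2) =
  arc (face G) x1 y1 d || arc (face G) x2 y2 (rev G d).
Proof.
case=> _ _ _ [o1 o2 _]; rewrite mem_cat mem_traject_arc //; congr (_ || _).
rewrite -{1}[d](@revK G) mem_map; last exact: perm_inj.
by rewrite mem_rev mem_traject_arc.
Qed.

Lemma face_walk_path x n :
  path (fun d d' => head d == tail d') x (traject (face G) (face G x) n).
Proof.
by elim: n x => //= n IHn x; rewrite tail_face eqxx IHn.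
Qed.

Lemma face_walk_cons x y : x != y -> y \in porbit (face G) x ->
  exists2 n, face_walk x y = x :: traject (face G) (face G x) n
    & head (last x (traject (face G) (face G x) n)) = tail y.
Proof.
move=> xDy yx; move: (yx); rewrite mem_porbit_fconnect => /iter_findex.
rewrite /face_walk; case E: findex => [|n].
  by move/eqP: E; rewrite findex_eq0 (negbTE xDy).
move=> H; exists n => //; suff -> : last x (traject (face G) (face G x) n) = iter n (face G) x.
  by rewrite -tail_face -iterS H.
by rewrite last_traject.
Qed.

(** Vertices differ within an arc because faces are simple, and across the arcs by
    [two_faces_tail_head]. An edge used in both directions would put one dart on both faces or both
    its darts on one face. *)
Lemma lens_is_cycle x1 y1 x2 y2 :
  two_faces x1 y1 x2 y2 -> is_cycle (lens x1 y1 x2 y2).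
Proof.
move=> tf; have tf' := two_faces_sym tf.
have D1 := two_faces_neq tf; have D2 := two_faces_neq tf'.
have [Ex Ey D [o1 o2 o12]] := tf.
apply/and4P; split.
- by rewrite /lens; have [n -> _] := face_walk_cons D1 o1.
- rewrite /lens; have [n1 -> l1] := face_walk_cons D1 o1.
  have [n2 -> l2] := face_walk_cons D2 o2.
  have := face_walk_path x2 n2; have := face_walk_path x1 n1.
  move: (traject _ _ n1) (traject _ _ n2) l1 l2 => t1 t2 l1 l2 w1 w2.
  rewrite (lastI x2) rev_rcons /= rcons_cat cat_path w1 /= tail_rev l1 l2 Ey.
  rewrite eqxx /= rcons_path last_map.
  have -> : last (last x2 t2) (seq.rev (belast x2 t2)) = x2.
    case: (t2) => //= a t; by rewrite rev_cons last_rcons.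
  rewrite head_rev Ex eqxx andbT path_map.
  rewrite -rev_path in w2; apply: sub_path w2 => a b /= /eqP E.
  by rewrite head_rev tail_rev E.
- rewrite map_cat cat_uniq; apply/and3P; split.
  + rewrite map_inj_in_uniq ?uniq_traject_arc // => a b.
    rewrite !mem_traject_arc // => /arc_porbit aa /arc_porbit ab; apply: sf.
    by apply: porbit_trans ab; rewrite porbit_sym.
  + apply/hasPn => t; rewrite -map_comp => /mapP [p]; rewrite mem_rev.
    rewrite mem_traject_arc // => ap ->; apply/negP => /mapP [q].
    rewrite mem_traject_arc //= tail_rev => aq /esym/eqP; apply/negP.
    exact: two_faces_tail_head tf aq ap.
  + rewrite -map_comp map_inj_in_uniq ?rev_uniq ?uniq_traject_arc // => a b.
    rewrite !mem_rev !mem_traject_arc //= => /arc_porbit aa /arc_porbit ab.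
    rewrite !tail_rev -!tail_face => /sf E; apply: (@perm_inj _ (face G)).
    apply: E; rewrite porbit_step; apply: porbit_trans ab.
    by rewrite porbit_sym porbit_step.
- apply/allP => d; rewrite !mem_lens // revK.
  have nb x y z : arc (face G) x y z -> arc (face G) x y (rev G z) -> False.
    move=> /arc_porbit az /arc_porbit arz; have/negP:= rev_notin_face sf z F1.
    by apply; apply: porbit_trans arz; rewrite porbit_sym.
  have d12 z : arc (face G) x1 y1 z -> arc (face G) x2 y2 z -> False.
    by move=> /arc_porbit a1 /arc_porbit; apply: two_faces_disjoint tf a1.
  move=> /orP[a|a]; apply/negP => /orP[b|b].
  + exact: nb a b.
  + exact: d12 a b.
  + exact: d12 b a.
  + exact: nb b a.
Qed.

Lemma on_lens_edge x1 y1 x2 y2 d : two_faces x1 y1 x2 y2 ->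
  on_cycle_edge (lens x1 y1 x2 y2) d =
  [|| arc (face G) x1 y1 d, arc (face G) x2 y2 (rev G d),
      arc (face G) x1 y1 (rev G d) | arc (face G) x2 y2 d].
Proof. by move=> tf; rewrite /on_cycle_edge !mem_lens // revK -orbA. Qed.

(** [glue] follows faces in one direction only, but orbits are cyclic. *)
Lemma glue_sym (c : seq (dart G)) : connect_sym (glue c).
Proof.
apply: connect_sym_step => x y /orP[/eqP->|/andP[nx /eqP->]].
  have: x \in porbit (face G) (face G x) by rewrite porbit_sym porbit_step porbit_id.
  apply: (porbit_ind (P := fun z => connect (glue c) (face G x) z)) => // z.
  by move/connect_trans; apply; apply: connect1; rewrite /glue /= eqxx.
apply: connect1; rewrite /glue /= revK eqxx andbT.
by move: nx; rewrite /on_cycle_edge revK orbC => ->; rewrite orbT.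
Qed.

Lemma outside_glue (c : seq (dart G)) x y :
  glue c x y -> outside c y = outside c x.
Proof.
by move=> xy; rewrite /outside (same_connect_r (glue_sym c) (connect1 xy)).
Qed.

(** If both faces were on one side, [outside] would not change across any edge, not even on the
    cycle by [two_faces_side], so every dart would be outside. Yet the coloring bounded by the cycle
    is constant on glued faces and tells the two faces apart. *)
Lemma lens_separates x1 y1 x2 y2 : two_faces x1 y1 x2 y2 ->
  outside (lens x1 y1 x2 y2) x1 != outside (lens x1 y1 x2 y2) x2.
Proof.
move=> tf; have tf' := two_faces_sym tf; set c := lens _ _ _ _.
have [Ex Ey D [o1 o2 o12]] := tf.
have gf d : outside c (face G d) = outside c d.
  by apply: outside_glue; rewrite /glue /= eqxx.
have ge d : ~~ on_cycle_edge c d -> outside c (rev G d) = outside c d.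
  by move=> nd; apply: outside_glue; rewrite /glue /= nd eqxx orbT.
apply/eqP => E.
have [y [yf yE yD]] := two_faces_coloring sf F1 tf.
have grev d : outside c (rev G d) = outside c d.
  have side1 z : arc (face G) x1 y1 z -> outside c (rev G z) = outside c z.
    move=> az; rewrite (porbit_invariant gf (arc_porbit az)) E.
    apply: (two_faces_side sf F1 tf gf) az => t n1 n2 n3 n4; apply: ge.
    by rewrite on_lens_edge // !negb_or n1 n2 n3 n4.
  have side2 z : arc (face G) x2 y2 z -> outside c (rev G z) = outside c z.
    move=> az; rewrite (porbit_invariant gf (arc_porbit az)) -E.
    apply: (two_faces_side sf F1 tf' gf) az => t n1 n2 n3 n4; apply: ge.
    by rewrite on_lens_edge // !negb_or n1 n2 n3 n4.
  have [|/ge//] := boolP (on_cycle_edge c d).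
  rewrite on_lens_edge // => /or4P[] a.
  - exact: side1.
  - by rewrite -(side2 _ a) revK.
  - by rewrite -(side1 _ a) revK.
  - exact: side2.
have all_out z : outside c z.
  apply: (@dart_ind G (outside c) (pg_outer G)); last exact: connect0.
    by move=> d; rewrite grev.
  by move=> d; rewrite rotE gf grev.
have yc z : y z = y (pg_outer G).
  apply: (connect_ind (P := fun z => y z = y (pg_outer G))) (all_out z) => //.
  move=> a b /orP[/eqP->|/andP[na /eqP->]]; first by rewrite yf.
  move=> <-; move: na (yE a); rewrite on_lens_edge // !negb_or /arc_edge.
  case/and4P => /negbTE-> /negbTE-> /negbTE-> /negbTE->.
  by case: (y a); case: (y _).
by rewrite !yc eqxx in yD.
Qed.

(** The edges of [q1] and [q2] are off the cycle and on the sides of the first and the second face,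
    so they witness that both regions are nonempty. *)
Lemma lens_separating x1 y1 x2 y2 q1 q2 : two_faces x1 y1 x2 y2 ->
  arc (face G) y1 x1 q1 -> rev G q1 \notin porbit (face G) x2 ->
  arc (face G) y2 x2 q2 -> rev G q2 \notin porbit (face G) x1 ->
  separating_cycle (lens x1 y1 x2 y2).
Proof.
move=> tf aq1 nq1 aq2 nq2; have tf' := two_faces_sym tf.
have D1 := two_faces_neq tf; have D2 := two_faces_neq tf'.
have [Ex Ey D [o1 o2 o12]] := tf.
set c := lens _ _ _ _.
have gf d : outside c (face G d) = outside c d.
  by apply: outside_glue; rewrite /glue /= eqxx.
have ox x y q : y \in porbit (face G) x -> arc (face G) y x q ->
    q \in porbit (face G) x.
  by move=> yx /arc_porbit; apply: porbit_trans.
have off u1 v1 u2 v2 q : two_faces u1 v1 u2 v2 -> arc (face G) v1 u1 q ->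
    rev G q \notin porbit (face G) u2 ->
    [/\ ~~ arc (face G) u1 v1 q, ~~ arc (face G) u1 v1 (rev G q),
        ~~ arc (face G) u2 v2 q & ~~ arc (face G) u2 v2 (rev G q)].
  move=> tfu aq nq; have [_ _ _ [p1 p2 p12]] := tfu.
  have qu := ox _ _ _ p1 aq; have Du := two_faces_neq tfu; split.
  - apply: arc_exclusive aq; [by rewrite eq_sym | by rewrite porbit_sym].
  - apply/negP => /arc_porbit rq; have/negP:= rev_notin_face sf q F1.
    by apply; apply: porbit_trans rq; rewrite porbit_sym.
  - by apply/negP => /arc_porbit; apply: two_faces_disjoint tfu qu.
  - by apply: contra nq; apply: arc_porbit.
have nc1 : ~~ on_cycle_edge c q1.
  have [n1 n2 n3 n4] := off _ _ _ _ _ tf aq1 nq1.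
  by rewrite on_lens_edge // !negb_or n1 n2 n3 n4.
have nc2 : ~~ on_cycle_edge c q2.
  have [n1 n2 n3 n4] := off _ _ _ _ _ tf' aq2 nq2.
  by rewrite on_lens_edge // !negb_or n1 n2 n3 n4.
have := lens_separates tf; rewrite -/c.
rewrite -(porbit_invariant gf (ox _ _ _ o1 aq1)).
rewrite -(porbit_invariant gf (ox _ _ _ o2 aq2)) => out.
split; first exact: lens_is_cycle.
(* Which of the two edges is inside depends on the position of [pg_outer]. *)
- right; apply/set0Pn; case E1: (outside c q1); [exists q2 | exists q1].
    by move: out; rewrite inE nc2 E1; case: outside.
  by rewrite inE nc1 E1.
- right; apply/set0Pn; case E1: (outside c q1); [exists q1 | exists q2].
    by rewrite inE nc1 E1.
  by move: out; rewrite inE nc2 E1; case: outside.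
Qed.

End Pinch.

(* The boundaries of two faces meet in something other than a path: they share
   two vertices, and each of the four boundary arcs between these has an edge
   that is not on the other face. *)
Definition pinched (G : plane_graph) : Prop :=
  exists x1 y1 x2 y2 : dart G, two_faces x1 y1 x2 y2 /\
  exists p1 q1 p2 q2 : dart G,
    [/\ arc (face G) x1 y1 p1 /\ rev G p1 \notin porbit (face G) x2,
        arc (face G) y1 x1 q1 /\ rev G q1 \notin porbit (face G) x2,
        arc (face G) x2 y2 p2 /\ rev G p2 \notin porbit (face G) x1
      & arc (face G) y2 x2 q2 /\ rev G q2 \notin porbit (face G) x1].

(** Face degrees count vertices; on a simple face these are as many as the darts. *)
Lemma card_face_le_max (G : plane_graph) (d : dart G) :
  simple_faces G -> #|porbit (face G) d| <= max_face_degree G.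
Proof.
move=> sf; apply: leq_trans (leq_bigmax_cond _ (porbit_in_porbits _ d)).
rewrite /face_degree card_in_imset // => a b da db.
by apply: sf; apply: porbit_trans db; rewrite porbit_sym.
Qed.

(* The two lenses bounded by complementary pairs of arcs have total length the
   sum of the two face degrees. *)
Lemma pinched_separating_cycle (G : plane_graph) :
  simple_faces G -> 1 < #|faces G| -> pinched G ->
  exists c : seq (dart G), separating_cycle c /\ size c <= max_face_degree G.
Proof.
move=> sf F1 [x1 [y1 [x2 [y2 [tf [p1 [q1 [p2 [q2]]]]]]]]].
case=> [[ap1 np1] [aq1 nq1] [ap2 np2] [aq2 nq2]].
have [Ex Ey D [o1 o2 o12]] := tf; have tfs := two_faces_swap tf.
have size_lens u1 v1 u2 v2 : size (lens u1 v1 u2 v2) =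
    findex (face G) u1 v1 + findex (face G) u2 v2.
  by rewrite size_cat size_map size_rev !size_traject.
have s1 := size_arcs (two_faces_neq tf) o1.
have s2 := size_arcs (two_faces_neq (two_faces_sym tf)) o2.
have m1 := card_face_le_max x1 sf; have m2 := card_face_le_max x2 sf.
have [le|gt] := leqP (size (lens x1 y1 x2 y2)) (max_face_degree G).
  by exists (lens x1 y1 x2 y2); split=> //; apply: lens_separating aq1 _ aq2 _.
exists (lens y1 x1 y2 x2); split.
  by apply: lens_separating ap1 _ ap2 _ => //;
     rewrite ?(porbit_same o1) ?(porbit_same o2).
by move: gt; rewrite !size_lens; lia.
Qed.

(** * Small cuts and parallel edges yield pinched faces *)

Definition avoiding (G : plane_graph) (S : {set vertex G}) : rel (vertex G) :=
  [rel x y | [&& x \notin S, y \notin S & adj x y]].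

Section Cuts.
Variable G : plane_graph.
Hypothesis sf : simple_faces G.
Implicit Types (d x y z : dart G) (u v a b t : vertex G) (S : {set vertex G}).

(** The edge set [B] changes only around [u] and [v]. The face passes each of these at most once and
    enters [B] at [u], so it leaves [B] at [v] and changes nowhere else. For [u = v] this is
    contradictory. *)
Lemma face_crosses_cut (B : pred (dart G)) u v x z :
  (forall d, B (rev G d) = B d) ->
  (forall d, tail d != u -> tail d != v -> B (rot G d) = B d) ->
  tail x = u -> face G z = x -> B x -> ~~ B z ->
  exists y, [/\ y \in porbit (face G) x, tail y = v /\ ~~ B y,
                forall d, arc (face G) x y d -> B d
              & forall d, arc (face G) y x d -> ~~ B d].
Proof.
move=> Brev Brot xu zx Bx nBz.
have Bface (t : dart G) : tail (face G t) != u -> tail (face G t) != v ->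
    B (face G t) = B t.
  by rewrite tail_face => tu tv; rewrite faceE Brot ?Brev.
have zo : z \in porbit (face G) x by rewrite porbit_sym -zx porbit_step porbit_id.
have [t to /andP[Bt nBft]] := perm_last_before Bx zo nBz.
have yo : face G t \in porbit (face G) x by rewrite porbit_step.
have yDx : face G t != x by apply: contraNneq nBft => ->.
have yDu : tail (face G t) != u.
  by rewrite -xu; apply: contra_neq yDx => E; apply/esym/sf.
have yv : tail (face G t) = v.
  apply/eqP/negPn/negP => yDv; move: nBft; by rewrite Bface // Bt.
have xDy : x != face G t by rewrite eq_sym.
have xo : x \in porbit (face G) (face G t) by rewrite porbit_sym.
have off s : s \in porbit (face G) x -> s != x -> s != face G t ->
    (tail s != u) * (tail s != v).
  move=> so sDx sDy; split; [rewrite -xu|rewrite -yv].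
    by apply: contra_neq sDx => E; apply/esym/sf.
  apply: contra_neq sDy => E; apply: sf => //.
  by apply: porbit_trans yo; rewrite porbit_sym.
exists (face G t); split=> // s.
- apply: (arc_ind (P := fun s => B s)) => // w aw fwD Bw.
  have fwx := arc_step_start xDy yo aw.
  have [|nu nv] := off (face G w) _ fwx fwD.
    by rewrite porbit_step (arc_porbit aw).
  by rewrite Bface.
- apply: (arc_ind (P := fun s => ~~ B s)) => // w aw fwD Bw.
  have fwx := arc_step_start yDx xo aw.
  have [|nu nv] := off (face G w) _ fwD fwx.
    by rewrite porbit_step; apply: porbit_trans yo (arc_porbit aw).
  by rewrite Bface.
Qed.

Hypothesis deg3 : forall d, rot G (rot G d) != d.

(** Two consecutive edges shared with the same face would meet in a vertex of degree 2, so an arc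
    with all its edges shared is a single edge. *)
Lemma arc_unshared x y w : x != y -> y \in porbit (face G) x ->
  (exists p, arc (face G) x y p /\ rev G p \notin porbit (face G) w) \/
  (face G x = y /\ rev G x \in porbit (face G) w).
Proof.
move=> xDy yo; have ax := arc_start (face G) xDy.
have [rx|nrx] := boolP (rev G x \in porbit (face G) w); last by left; exists x.
have [E|fxD] := eqVneq (face G x) y; first by right.
have afx := arc_step xDy yo ax fxD.
have [rfx|] := boolP (rev G (face G x) \in porbit (face G) w); last first.
  by left; exists (face G x).
suff E : face G (rev G (face G x)) = rev G x.
  by have:= deg3 (rev G x); rewrite -faceE rotE E eqxx.
apply: sf; last by rewrite tail_face head_rev tail_face.
by rewrite porbit_sym porbit_step porbit_sym (porbit_same rfx).
Qed.

(** The corners of [u] where the rotation leaves and enters [A] lie on two faces, which both change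
    sides again at [v]. An arc without an unshared edge would be a single edge from [u] to [v],
    alone in its block of darts around [u]; the last two hypotheses exclude this. *)
Lemma pinched_of_cut (A : pred (dart G)) u v d d' :
  u != v ->
  (forall z, A (rev G z) = A z) ->
  (forall z, tail z != u -> tail z != v -> A (rot G z) = A z) ->
  tail d = u -> tail d' = u ->
  A d -> ~~ A (rot G d) -> ~~ A d' -> A (rot G d') ->
  (rot G d = d' -> head d' != v) -> (rot G d' = d -> head d != v) ->
  pinched G.
Proof.
move=> uDv Arev Arot du d'u Ad nAx1 nAd' Ax2 c1 c2.
pose nA := predC A.
have [||||||y1 [o1 [y1v _] arc1 _]] := @face_crosses_cut nA u v (rot G d) (rev G d).
- by move=> z; rewrite /nA /= Arev.
- by move=> z zu zv; rewrite /nA /= Arot.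
- by rewrite tail_rot.
- by rewrite -rotE.
- by [].
- by rewrite /nA /= Arev negbK.
have [||||||y2 [o2 [y2v _] arc2 _]] := @face_crosses_cut A u v (rot G d') (rev G d').
- by [].
- by [].
- by rewrite tail_rot.
- by rewrite -rotE.
- by [].
- by rewrite Arev.
have t1 : tail (rot G d) = u by rewrite tail_rot.
have t2 : tail (rot G d') = u by rewrite tail_rot.
have D1 : rot G d != y1 by apply: contra_neq uDv => E; rewrite -t1 E.
have D2 : rot G d' != y2 by apply: contra_neq uDv => E; rewrite -t2 E.
have at_u x z : tail x = u -> tail z = u -> z \in porbit (face G) x -> x = z.
  by move=> xu zu zo; apply: sf zo _; rewrite xu zu.
have tf : two_faces (rot G d) y1 (rot G d') y2.
  split; rewrite ?t1 ?t2 ?y1v ?y2v //; split=> //.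
  apply/negP => /(at_u _ _ t1 t2) E; by rewrite E Ax2 in nAx1.
have o1' : rot G d \in porbit (face G) y1 by rewrite porbit_sym.
have o2' : rot G d' \in porbit (face G) y2 by rewrite porbit_sym.
have D1' : y1 != rot G d by rewrite eq_sym.
have D2' : y2 != rot G d' by rewrite eq_sym.
have face_inj := @perm_inj _ (face G); have rot_inj := @perm_inj _ (rot G).
exists (rot G d), y1, (rot G d'), y2; split=> //.
have [[p1 P1]|[E R]] := arc_unshared (rot G d') D1 o1; last first.
  have hv : head (rot G d) = v by rewrite -tail_face E.
  have Er : rot G d' = rot G (rot G d).
    apply: at_u; rewrite ?tail_rot //.
    by rewrite (rotE (rot G d)) porbit_step.
  by have:= c1 (esym (rot_inj _ _ Er)); rewrite (rot_inj _ _ Er) hv eqxx.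
have [[q1 Q1]|[E R]] := arc_unshared (rot G d') D1' o1'; last first.
  have Ey : y1 = rev G d by apply: face_inj; rewrite E -rotE.
  rewrite Ey revK in R; have:= c2 (at_u _ _ t2 du R).
  by rewrite -tail_rev -Ey y1v eqxx.
have [[p2 P2]|[E R]] := arc_unshared (rot G d) D2 o2; last first.
  have hv : head (rot G d') = v by rewrite -tail_face E.
  have Er : rot G d = rot G (rot G d').
    apply: at_u; rewrite ?tail_rot //.
    by rewrite (rotE (rot G d')) porbit_step.
  by have:= c2 (esym (rot_inj _ _ Er)); rewrite (rot_inj _ _ Er) hv eqxx.
have [[q2 Q2]|[E R]] := arc_unshared (rot G d) D2' o2'; last first.
  have Ey : y2 = rev G d' by apply: face_inj; rewrite E -rotE.
  rewrite Ey revK in R; have:= c1 (at_u _ _ t1 d'u R).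
  by rewrite -tail_rev -Ey y2v eqxx.
by exists p1, q1, p2, q2.
Qed.

Lemma avoiding_sym S : connect_sym (avoiding S).
Proof.
apply: connect_sym_step => x y /and3P[xS yS xy]; apply: connect1.
by rewrite /avoiding /= xS yS adj_sym.
Qed.

Lemma avoiding_notin S a t : a \notin S -> connect (avoiding S) a t -> t \notin S.
Proof.
move=> aS; apply: (connect_ind (P := fun t => t \notin S)) => //.
by move=> x y /and3P[].
Qed.

(** The edges meeting the component of [a] outside [S] form a set that changes only around vertices
    of [S], as [face_crosses_cut] requires. *)
Definition touches S a d :=
  connect (avoiding S) a (tail d) || connect (avoiding S) a (head d).

Lemma touches_rev S a d : touches S a (rev G d) = touches S a d.
Proof. by rewrite /touches head_rev tail_rev orbC. Qed.

Lemma touches_tail S a d : a \notin S -> tail d \notin S ->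
  touches S a d = connect (avoiding S) a (tail d).
Proof.
move=> aS dS; apply/idP/idP => [/orP[ct|ch]|ct] //; last by rewrite /touches ct.
apply: (connect_trans ch); apply: connect1.
rewrite /avoiding /= dS (avoiding_notin aS ch) /=.
by apply/adjP; exists (rev G d); rewrite ?head_rev.
Qed.

Lemma touches_rot S a d : a \notin S -> tail d \notin S ->
  touches S a (rot G d) = touches S a d.
Proof. by move=> aS dS; rewrite !touches_tail ?tail_rot. Qed.

(** At a cut vertex some corner joins the two sides, and the face of this corner would have to
    revisit the same vertex to change sides again. *)
Lemma no_cut_vertex t a b : a != t -> b != t -> connect (avoiding [set t]) a b.
Proof.
move=> aDt bDt; apply/negPn/negP => ncab.
have aS : a \notin [set t] by rewrite inE.
pose A := touches [set t] a.
have [da Ea] := vertex_dart a; have [db Eb] := vertex_dart b.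
have Ada : A da by rewrite /A touches_tail ?Ea ?connect0.
have nAdb : ~~ A db by rewrite /A touches_tail ?Eb // inE.
have Arot d : tail d != t -> A (rot G d) = A d.
  by move=> dt; apply: touches_rot; rewrite // inE.
have [d /andP[Ad nAd]|none] := pickP [pred d | A d && ~~ A (rot G d)]; last first.
  move/negP: nAdb; apply; apply: (@dart_ind _ A da) => // d Ad.
    by rewrite /A touches_rev.
  by have:= none d; rewrite /= Ad => /negbFE.
have dt : tail d = t.
  by apply/eqP/negPn/negP => dt; rewrite Arot // Ad in nAd.
have [||||||y [yo [yt]]] := @face_crosses_cut (predC A) t t (rot G d) (rev G d).
- by move=> z; rewrite /= /A touches_rev.
- by move=> z zt _; rewrite /= Arot.
- by rewrite tail_rot.
- by rewrite -rotE.
- by [].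
- by rewrite /= negbK /A touches_rev.
rewrite -(sf yo) /= ?nAd //; first by rewrite tail_rot yt.
Qed.

(** [d] ends a block of darts outside [A]. By the last clause a block of one dart can only be [y],
    which serves to verify a hypothesis of [pinched_of_cut] on single edges. *)
Lemma first_entry (A : pred (dart G)) y z :
  ~~ A y -> A z -> tail y = tail z ->
  exists d, [/\ tail d = tail y, ~~ A d, A (rot G d)
              & forall x, A x -> rot G x = d -> d = y].
Proof.
move=> nAy Az Eyz.
pose P d := ~~ A d && ((d == y) || ~~ A ((rot G)^-1 d)%g).
have zo : z \in porbit (rot G) y by rewrite -eq_tail Eyz.
have Py : P y by rewrite /P nAy eqxx.
have nPz : ~~ P z by rewrite /P Az.
have [d dr /andP[/andP[nAd Pd] nPr]] := perm_last_before Py zo nPz.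
exists d; split=> //.
- by apply/esym/eqP; rewrite eq_tail.
- by apply/negPn; move: nPr; rewrite /P permK nAd orbT andbT.
- move=> x Ax xd; case/orP: Pd => [/eqP//|]; by rewrite -xd permK Ax.
Qed.

Lemma pinched_of_2cut u v a b : u != v ->
  a \notin [set u; v] -> b \notin [set u; v] ->
  ~~ connect (avoiding [set u; v]) a b -> pinched G.
Proof.
move=> uDv aS bS nab.
(* Both sides of the cut have an edge to [u], as otherwise [v] alone would separate them. *)
have branch a' b' : a' \notin [set u; v] -> b' \notin [set u; v] ->
    ~~ connect (avoiding [set u; v]) a' b' ->
    exists2 d, tail d = u & connect (avoiding [set u; v]) a' (head d).
  move=> aS' bS' nab'.
  have [d /andP[/eqP du dc]|none] :=
    pickP [pred d | (tail d == u) && connect (avoiding [set u; v]) a' (head d)].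
    by exists d.
  case/negP: nab'.
  have: connect (avoiding [set v]) a' b'.
    apply: no_cut_vertex.
      by apply: contraNneq aS' => ->; rewrite !inE eqxx orbT.
    by apply: contraNneq bS' => ->; rewrite !inE eqxx orbT.
  apply: (connect_ind (P := fun t => connect (avoiding [set u; v]) a' t)) => //.
  move=> s t /and3P[sv tv /adjP[d ds dt]] cs.
  have sS := avoiding_notin aS' cs.
  apply: (connect_trans cs); apply: connect1; rewrite /avoiding /= sS /=.
  apply/andP; split; last by apply/adjP; exists d.
  rewrite !inE negb_or; move: tv; rewrite inE => ->; rewrite andbT.
  apply/eqP => tu; have:= none (rev G d).
  by rewrite /= tail_rev dt tu eqxx head_rev ds cs.
pose A := touches [set u; v] a.
have uS : u \in [set u; v] by rewrite !inE eqxx.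
have vS : v \in [set u; v] by rewrite !inE eqxx orbT.
have nS t : t \in [set u; v] -> connect (avoiding [set u; v]) a t = false.
  by move=> tS; apply/negP => /(avoiding_notin aS); rewrite tS.
have [z zu zc] := branch a b aS bS nab.
have [|y yu yc] := branch b a bS aS; first by rewrite avoiding_sym.
have Az : A z by rewrite /A /touches zc orbT.
have nAy : ~~ A y.
  rewrite /A /touches yu nS //=; apply: contra nab => /connect_trans; apply.
  by rewrite avoiding_sym.
have yz : tail y = tail z by rewrite yu zu.
have [d' [d'u nAd' Ard' d'y]] := first_entry nAy Az yz.
have yzo : y \in porbit (rot G) z by rewrite -eq_tail yz.
have [d do_ /andP[Ad nArd]] := perm_last_before Az yzo nAy.
have du : tail d = u by rewrite -zu; apply/esym/eqP; rewrite eq_tail.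
apply: (@pinched_of_cut A u v d d') => //.
- by move=> t; rewrite /A touches_rev.
- by move=> t tu tv; rewrite /A touches_rot // !inE negb_or tu.
- by rewrite d'u.
(* A block of one dart outside [A] is [y], which leads to the component of [b]; the darts of [A] at
   [u] lead to that of [a]. Neither ends in [v]. *)
- move/(d'y _ Ad) ->; apply: contraTneq yc => ->; apply/negP.
  by move/(avoiding_notin bS); rewrite vS.
- move=> _; apply: contraTneq Ad => hd.
  by rewrite /A /touches du hd !nS.
Qed.

(** An instance of [pinched_of_cut] with the two parallel edges as [A]: the rotation leaves [A]
    after [d2] and enters it after [d']. *)
Lemma pinched_of_digon d1 d2 d' : d1 != d2 ->
  tail d1 = tail d2 -> head d1 = head d2 ->
  d' != d1 -> d' != d2 -> rot G d' = d1 ->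
  (rot G d2 = d' -> head d' != head d1) -> pinched G.
Proof.
move=> d12 Et Eh d'D1 d'D2 rd' c1.
pose A : pred (dart G) := mem [:: d1; d2; rev G d1; rev G d2].
have Au z : tail z = tail d1 -> A z = (z == d1) || (z == d2).
  have nr d : tail d = tail d1 -> tail z = tail d1 -> (z == rev G d) = false.
    move=> dt zt; apply/eqP => E; have:= pg_loopless d.
    by rewrite -E zt dt eqxx.
  by move=> zt; rewrite /A /= !inE !nr ?orbF.
have d't : tail d' = tail d1 by rewrite -rd' tail_rot.
apply: (@pinched_of_cut A (tail d1) (head d1) d2 d') => //.
- by rewrite eq_sym pg_loopless.
- move=> z; rewrite /A /= !inE !(inj_eq perm_inj).
  have R d : (rev G z == d) = (z == rev G d).
    by rewrite -(inj_eq (@perm_inj _ (rev G))) revK.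
  by rewrite !R; do !case: (_ == _).
- have nA z : tail z != tail d1 -> tail z != head d1 -> ~~ A z.
    move=> zt zh; rewrite /A /= !inE !negb_or; apply/and4P; split.
    + by apply: contraNneq zt => ->.
    + by apply: contraNneq zt => ->; rewrite Et.
    + by apply: contraNneq zh => ->.
    + by apply: contraNneq zh => ->; rewrite Eh.
  by move=> z zt zh; rewrite (negbTE (nA _ zt zh)) (negbTE (nA _ _ _)) // tail_rot.
- by rewrite Au // eqxx orbT.
- rewrite Au ?tail_rot // negb_or; apply/andP; split.
    by apply: contra_neq d'D2; rewrite -rd' => /perm_inj.
  by apply/eqP => E; have:= deg3 d2; rewrite !E eqxx.
- by rewrite Au // negb_or d'D1.
- by rewrite rd' Au // eqxx.
- by rewrite rd' => E; rewrite E eqxx in d12.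
Qed.

End Cuts.

(** * Graphs of minimum degree 3 *)

Section MinimumDegree3.
Variable G : plane_graph.
Hypothesis sf : simple_faces G.
Hypothesis F4 : 4 <= #|faces G|.
Hypothesis deg3 : forall d : dart G, rot G (rot G d) != d.
Implicit Types (d : dart G) (u v a b t : vertex G) (S : {set vertex G}).

(** With two vertices and at least four faces, Euler's formula gives at least four edges, and each
    has a dart at [tail d1]. *)
Lemma dipole_degree d1 :
  (forall t, t = tail d1 \/ t = head d1) -> 4 <= #|porbit (rot G) d1|.
Proof.
move=> all2; have uDv : tail d1 != head d1 by rewrite eq_sym pg_loopless.
have cV : 2 <= #|vertex G|.
  by have <- : #|[set tail d1; head d1]| = 2; rewrite ?max_card // cards2 uDv.
have cE : #|porbits (rev G)| <= #|porbit (rot G) d1|.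
  apply: leq_trans (leq_imset_card (porbit (rev G)) (porbit (rot G) d1)).
  apply: subset_leq_card; apply/subsetP => O /imsetP [d _ ->].
  have [/esym/eqP du|dv] := all2 (tail d).
    by rewrite eq_tail in du; apply: imset_f.
  have /esym/eqP du : tail (rev G d) = tail d1.
    by case: (all2 (tail (rev G d))) => // E; have:= pg_loopless d; rewrite dv E eqxx.
  rewrite eq_tail in du; apply/imsetP; exists (rev G d) => //.
  by apply/esym/porbit_same; rewrite porbit_step porbit_id.
have:= euler_rot G; rewrite -card_vertex; move: F4 cV cE; rewrite /faces.
move=> f4 v2 le_E euler; apply: leq_trans le_E.
by rewrite -(leq_add2r 2) -euler addnC leq_add.
Qed.

(** If some edge at [tail d1] does not lead to [head d1], it serves as [y] in [first_entry].
    Otherwise the graph has only two vertices, and another pair of parallel edges is chosen. *)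
Lemma pinched_of_parallel d1 d2 : d1 != d2 ->
  tail d1 = tail d2 -> head d1 = head d2 -> pinched G.
Proof.
move=> d12 Et Eh; have d21 : d2 != d1 by rewrite eq_sym.
have [y /andP[/eqP yt yh]|none] :=
    pickP [pred y | (tail y == tail d1) && (head y != head d1)].
  pose A := [pred z | (z == d1) || (z == d2)].
  have nAy : ~~ A y.
    by apply: contra yh => /orP[]/eqP->; rewrite ?Eh.
  have Ad1 : A d1 by rewrite /A /= eqxx.
  have Ad2 : A d2 by rewrite /A /= eqxx orbT.
  have [d' [d't nAd' Ad' d'y]] := first_entry nAy Ad1 yt.
  move: nAd'; rewrite /A /= negb_or => /andP[nd1 nd2].
  case/orP: Ad' => /eqP E.
    by apply: (pinched_of_digon sf deg3 d12 Et Eh nd1 nd2 E) => /(d'y _ Ad2) ->.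
  apply: (pinched_of_digon sf deg3 d21 (esym Et) (esym Eh) nd2 nd1 E).
  by move=> /(d'y _ Ad1) ->; rewrite -Eh.
have uDv : tail d1 != head d1 by rewrite eq_sym pg_loopless.
have hv d : tail d = tail d1 -> head d = head d1.
  by move=> dt; have:= none d; rewrite /= dt eqxx => /negbFE/eqP.
(* A third vertex would be cut off from [tail d1] by [head d1]. *)
have all2 t : t = tail d1 \/ t = head d1.
  have [->|tDv] := eqVneq t (head d1); first by right.
  left; have:= no_cut_vertex sf uDv tDv.
  apply: (connect_ind (P := fun s => s = tail d1)) => // x y.
  move=> /and3P[_ yv /adjP[d dx dy]] xE; move: yv.
  by rewrite -dy hv ?dx // inE eqxx.
have n4 := dipole_degree all2.
have:= uniq_traject_porbit (rot G) d1; rewrite -(subnKC n4) trajectD cat_uniq.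
move=> /andP[/=]; rewrite !inE !negb_or => /and4P[/and3P[n1 n2 n3] _ _ _] _.
(* [d1] and its successor form the digon; by degree at least 4, the block of the remaining darts,
   which ends with [d'], has more than one dart. *)
pose d' := ((rot G)^-1 d1)%g; have rd' : rot G d' = d1 by rewrite permKV.
have rr : rot G d1 != d1 by rewrite eq_sym.
apply: (@pinched_of_digon G sf deg3 d1 (rot G d1) d') => //.
- by rewrite tail_rot.
- by rewrite [RHS]hv // tail_rot.
- by apply: contra_neq rr => E; rewrite -{1}E rd'.
- by apply: contra_neq n2 => E; rewrite -E rd'.
- by move=> E; case/eqP: n3; rewrite E rd'.
Qed.

Lemma simple_card_vertex : simple_graph G -> 3 < #|vertex G|.
Proof.
move=> simple; pose d := pg_outer G; pose r := rot G.
have rD (x : dart G) : r x != x by apply/eqP => E; have:= deg3 x; rewrite -/r !E eqxx.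
have hD (x y : dart G) : tail x = tail y -> x != y -> head x != head y.
  by move=> E; apply: contra_neq; apply: simple.
have lD (x : dart G) : tail x = tail d -> head x != tail d by move=> <-; apply: pg_loopless.
have tr (x : dart G) : tail (r x) = tail x by apply: tail_rot.
have: uniq [:: tail d; head d; head (r d); head (r (r d))].
  rewrite /= !inE !negb_or ![tail d == _]eq_sym !lD ?tr //=.
  by rewrite !hD ?tr // eq_sym.
by move/card_uniqP => /= <-; apply: max_card.
Qed.

Lemma deg3_dichotomy : pinched G \/ simple_graph G /\ k_connected G 3.
Proof.
have [/forallP simpleb|] := boolP [forall d1 : dart G, [forall d2 : dart G,
    (tail d1 == tail d2) && (head d1 == head d2) ==> (d1 == d2)]]; last first.
  rewrite negb_forall => /existsP[d1]; rewrite negb_forall => /existsP[d2].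
  rewrite negb_imply => /andP[/andP[/eqP Et /eqP Eh] d12].
  by left; apply: pinched_of_parallel Et Eh.
have simple : simple_graph G.
  move=> d1 d2 Et Eh; have /forallP/(_ d2) := simpleb d1.
  by rewrite Et Eh !eqxx => /eqP.
have V4 := simple_card_vertex simple.
have [/forallP conn|] := boolP [forall S : {set vertex G}, [forall a, [forall b,
    [&& #|S| == 2, a \notin S & b \notin S] ==> connect (avoiding S) a b]]];
  last first.
  rewrite negb_forall => /existsP[S]; rewrite negb_forall => /existsP[a].
  rewrite negb_forall => /existsP[b]; rewrite negb_imply.
  case/andP=> /and3P[/cards2P[u [v [uDv ->]]] aS bS] nab.
  by left; apply: pinched_of_2cut nab.
right; split=> //; split=> // S S3 a b aS bS.
(* A smaller set is enlarged to two vertices other than [a] and [b], which is possible with at least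
   four vertices; a path avoiding the larger set avoids [S]. *)
have grow k : k <= 2 -> #|S| <= k ->
    exists S' : {set vertex G}, [/\ #|S'| = k, S \subset S', a \notin S' & b \notin S'].
  elim: k => [|k IHk] k2.
    by rewrite leqn0 => S0; exists S; rewrite (eqP S0).
  rewrite leq_eqVlt => /orP[/eqP E|lt_k]; first by exists S.
  have [S' [cS' sS aS' bS']] := IHk (ltnW k2) lt_k.
  have [t|none] := pickP [pred t | t \notin a |: (b |: S')].
    rewrite !inE !negb_or => /and3P[ta tb tS]; exists (t |: S'); split.
    - by rewrite cardsU1 tS cS'.
    - exact: subset_trans sS (subsetUr _ _).
    - by rewrite !inE negb_or eq_sym ta.
    - by rewrite !inE negb_or eq_sym tb.
  have: #|vertex G| <= #|a |: (b |: S')|.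
    rewrite -cardsT; apply: subset_leq_card; apply/subsetP => t _.
    by have:= none t => /negbFE.
  by rewrite !cardsU1 cS'; move: V4 k2; do 2!case: (_ \notin _); lia.
have [S' [cS' sS aS' bS']] := grow 2 isT S3.
have /forallP/(_ a)/forallP/(_ b) := conn S'.
rewrite cS' aS' bS' /=; apply: connect_sub => x y /and3P[xS yS xy].
apply: connect1; rewrite /= xy (contra (subsetP sS x)) //.
by rewrite (contra (subsetP sS y)).
Qed.

End MinimumDegree3.

(** * Suppression of a vertex of degree 2 *)

Lemma card_porbits_involution (T : finType) (e : {perm T}) :
  involutive e -> (forall d, e d != d) -> #|porbits e| * 2 = #|T|.
Proof.
move=> eK eD; rewrite -[#|T|]sum1_card.
rewrite (partition_big (@orbit_index T e) predT) //=.
rewrite (eq_bigr (fun=> 2)) ?sum_nat_const ?card_ord // => i _.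
rewrite sum1_card -(orbit_reprK i); set d := orbit_repr i.
have <- : #|[set d; e d]| = 2 by rewrite cards2 eq_sym eD.
apply: eq_card => x; rewrite !inE [LHS]orbit_indexE.
apply/idP/orP => [|[]/eqP->]; last 2 first.
- exact: porbit_id.
- by rewrite porbit_step porbit_id.
apply: (@porbit_ind T e (fun z => z == d \/ z == e d)); first by left.
by move=> z [/eqP->|/eqP->]; [right | left; rewrite eK].
Qed.

Section SubPerm.
Variables (T : finType) (P : pred T) (s : {perm T}) (s' : {perm {x : T | P x}}).
Hypothesis s'E : forall x, val (s' x) =
  if P (s (val x)) then s (val x) else s (s (val x)).

(** [s'] is [s] with elements outside [P] skipped, at most one at a time. The converse needs strong
    induction, as a step of [s'] uses up one or two steps of [s]. *)
Lemma porbit_sub x y : (y \in porbit s' x) = (val y \in porbit s (val x)).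
Proof.
apply/idP/idP => [|/porbitP [i]].
  apply: (@porbit_ind _ s' (fun z => val z \in porbit s (val x))).
    exact: porbit_id.
  by move=> z; rewrite s'E; case: ifP; rewrite !porbit_step.
rewrite permX; move: x; have [n] := ubnP i.
elim: n i => // n IHn [|i] lt_i x E.
  by rewrite -(val_inj E) porbit_id.
rewrite -(porbit_same (y := s' x)) ?porbit_step ?porbit_id //.
have := s'E x; case: ifP => [_ E'|nP E'].
  by apply: (IHn i) => //; rewrite E E' iterSr.
case: i lt_i E => [|i] lt_i E; first by rewrite -[s (val x)]E (valP y) in nP.
by apply: (IHn i); [apply: ltnW | rewrite E E' !iterSr].
Qed.

Lemma arc_sub x y z : x != y -> y \in porbit s' x ->
  arc s' x y z -> arc s (val x) (val y) (val z).
Proof.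
move=> xDy yx; have vD : val x != val y by rewrite val_eqE.
have vo : val y \in porbit s (val x) by rewrite -porbit_sub.
apply: (arc_ind (P := fun z => arc s (val x) (val y) (val z))) => //.
  exact: arc_start.
move=> w _; rewrite -val_eqE s'E; case: ifP => [_ D aw|nP D aw].
  exact: arc_step.
do 2!apply: arc_step => //; apply/eqP => E.
by rewrite E (valP y) in nP.
Qed.

Hypothesis P_orbit : forall x, ~~ P x -> P (s x).

Lemma card_porbits_sub : #|porbits s'| = #|porbits s|.
Proof.
have repP x : exists y : {x : T | P x}, val y \in porbit s x.
  have [Px|nPx] := boolP (P x); first by exists (Sub x Px); rewrite porbit_id.
  by exists (Sub (s x) (P_orbit nPx)); rewrite porbit_step porbit_id.
pose f (O : {set T}) : {set {x : T | P x}} := [set y | val y \in O].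
have fE x : f (porbit s (val x)) = porbit s' x.
  by apply/setP => y; rewrite inE porbit_sub.
have f_inj : {in porbits s &, injective f}.
  move=> _ _ /imsetP[x _ ->] /imsetP[y _ ->]; have [z zx] := repP x.
  move/setP/(_ z); rewrite !inE zx => /esym zy.
  by rewrite -(porbit_same zx) (porbit_same zy).
rewrite -(card_in_imset f_inj); apply: eq_card => O.
apply/imsetP/imsetP => [[x _ ->]|[_ /imsetP[x _ ->] ->]].
  by exists (porbit s (val x)); rewrite ?fE // imset_f.
have [z zx] := repP x; exists z => //.
by rewrite -(porbit_same zx) fE.
Qed.

End SubPerm.

Section Suppress.
Variable G : plane_graph.
Hypothesis sf : simple_faces G.
Hypothesis F3 : 2 < #|faces G|.
Variable a : dart G.
Hypothesis rra : rot G (rot G a) = a.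
Implicit Types d x y : dart G.

Let b := rot G a.
Let w := tail a.

Let F1 : 1 < #|faces G|. Proof. exact: ltnW. Qed.

Let rotb : rot G b = a. Proof. exact: rra. Qed.

Let face_ra : face G (rev G a) = b. Proof. by rewrite -rotE. Qed.

Let face_rb : face G (rev G b) = a. Proof. by rewrite -rotE. Qed.

(** A vertex of degree 1 would have the same face on both sides of its edge. *)
Let bDa : b != a.
Proof.
apply/eqP => E; have:= rev_notin_face sf a F1.
by rewrite porbit_sym -{1}E -face_ra porbit_step porbit_id.
Qed.

Let tailb : tail b = w. Proof. by rewrite tail_rot. Qed.

Let tail_w d : (tail d == w) = (d == a) || (d == b).
Proof.
rewrite eq_sym eq_tail; apply/idP/orP => [|[]/eqP->]; last 2 first.
- exact: porbit_id.
- by rewrite porbit_step porbit_id.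
apply: (@porbit_ind _ (rot G) (fun z => z == a \/ z == b)); first by left.
by move=> z [/eqP->|/eqP->]; [right | left; rewrite rotb].
Qed.

(** Merging the two edges at [w] must not create a loop. With equal heads, simple faces would force
    these edges to be the whole graph, with at most two faces. *)
Let heads : head a != head b.
Proof.
apply/eqP => E.
have E1 : rot G (rev G b) = rev G a.
  apply/esym/sf; last by rewrite tail_rot !tail_rev.
  by rewrite -faceE porbit_step -face_ra porbit_step porbit_id.
have E2 : rot G (rev G a) = rev G b.
  apply/esym/sf; last by rewrite tail_rot !tail_rev.
  by rewrite -faceE porbit_step -face_rb porbit_step porbit_id.
have all4 d : d \in [:: a; b; rev G a; rev G b].
  apply: (@dart_ind G (mem [:: a; b; rev G a; rev G b]) a).
  - by move=> z; rewrite /= !inE => /or4P[]/eqP->; rewrite ?revK eqxx ?orbT.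
  - move=> z; rewrite /= !inE => /or4P[]/eqP->.
    + by rewrite eqxx orbT.
    + by rewrite rotb eqxx.
    + by rewrite E2 eqxx !orbT.
    + by rewrite E1 eqxx !orbT.
  - by rewrite /= !inE eqxx.
have: #|faces G| <= 2; last by rewrite leqNgt F3.
apply: leq_trans (_ : #|[set porbit (face G) a; porbit (face G) b]| <= 2).
  apply: subset_leq_card; apply/subsetP => O /imsetP[d _ ->].
  rewrite !inE; have:= all4 d; rewrite !inE => /or4P[]/eqP->.
  - by rewrite eqxx.
  - by rewrite eqxx orbT.
  - by rewrite !eq_porbit_mem orbC porbit_sym -{1}face_ra porbit_step porbit_id.
  - by rewrite !eq_porbit_mem porbit_sym -{1}face_rb porbit_step porbit_id.
by rewrite cards2; case: (_ != _).
Qed.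

(** Only the darts leaving [w] are removed; [rev a] and [rev b] stay and become the two darts of the
    merged edge. *)
Let kept : pred (dart G) := [pred d | (d != a) && (d != b)].
Let sdart : finType := {d : dart G | kept d}.
Let svertex : finType := {v : vertex G | v != w}.

Let keptE d : kept d = (tail d != w).
Proof. by rewrite tail_w negb_or. Qed.

Let stail (d : sdart) : svertex :=
  Sub (tail (val d)) (etrans (esym (keptE (val d))) (valP d)).

Let kept_ra : kept (rev G a).
Proof. by rewrite keptE pg_loopless. Qed.

Let kept_rb : kept (rev G b).
Proof. by rewrite keptE -tailb pg_loopless. Qed.

Let srev_fun d :=
  if d == rev G a then rev G b else if d == rev G b then rev G a else rev G d.

Let kept_srev d : kept d -> kept (srev_fun d).
Proof.
rewrite /srev_fun; case: eqP => // /eqP nra; case: eqP => // /eqP nrb _.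
have R x y : (rev G x == y) = (x == rev G y).
  by rewrite -(inj_eq (@perm_inj _ (rev G))) revK.
by rewrite /kept /= !R nra nrb.
Qed.

Let raDrb : rev G a != rev G b.
Proof. by apply: contra_neq heads => E; rewrite -!tail_rev E. Qed.

Let srev_funK d : kept d -> srev_fun (srev_fun d) = d.
Proof.
move=> kd; rewrite /srev_fun.
have [->|nra] := eqVneq d (rev G a).
  by rewrite eq_sym (negbTE raDrb) eqxx.
have [->|nrb] := eqVneq d (rev G b); first by rewrite eqxx.
move: kd; rewrite /kept /= => /andP[na nb].
by rewrite !(inj_eq perm_inj) (negbTE na) (negbTE nb) revK.
Qed.

Let srev_map (d : sdart) : sdart := Sub (srev_fun (val d)) (kept_srev (valP d)).

Let srev_mapK : involutive srev_map.
Proof. by move=> d; apply: val_inj; rewrite /= srev_funK // (valP d). Qed.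

Let srev : {perm sdart} := perm (inv_inj srev_mapK).

Let srevE (d : sdart) : val (srev d) = srev_fun (val d).
Proof. by rewrite permE. Qed.

Let kept_rot d : kept d -> kept (rot G d).
Proof. by rewrite !keptE tail_rot. Qed.

Let srot_map (d : sdart) : sdart := Sub (rot G (val d)) (kept_rot (valP d)).

Let srot_map_inj : injective srot_map.
Proof.
by move=> d d' /(congr1 val) /= /perm_inj E; apply: val_inj.
Qed.

Let srot : {perm sdart} := perm srot_map_inj.

Let srotE (d : sdart) : val (srot d) = rot G (val d).
Proof. by rewrite permE. Qed.

(** If the marker of the unbounded face is removed, the dart preceding it on that face takes its
    place. *)
Let souter : sdart :=
  if insub (pg_outer G) is Some d then d
  else if pg_outer G == a then Sub (rev G b) kept_rb
  else Sub (rev G a) kept_ra.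

Let souterE : val souter \in porbit (face G) (pg_outer G).
Proof.
rewrite /souter; case: insubP => [d _ ->|]; first exact: porbit_id.
rewrite negb_and !negbK; case: eqP => [-> _|_ /= /eqP->] /=.
  by rewrite porbit_sym -{1}face_rb porbit_step porbit_id.
by rewrite porbit_sym -{1}face_ra porbit_step porbit_id.
Qed.

Let srevK : involutive srev.
Proof. by move=> d; rewrite !permE srev_mapK. Qed.

Let sloopless (d : sdart) : stail (srev d) != stail d.
Proof.
rewrite -val_eqE /= srevE /srev_fun.
have [->|nra] := eqVneq (val d) (rev G a).
  by rewrite !tail_rev eq_sym heads.
have [->|nrb] := eqVneq (val d) (rev G b); first by rewrite !tail_rev heads.
exact: pg_loopless.
Qed.

Let srotP (d d' : sdart) : (stail d == stail d') = (d' \in porbit srot d).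
Proof.
rewrite -val_eqE /= eq_tail (@porbit_sub _ _ (rot G)) // => x.
by rewrite srotE ifT // kept_rot // (valP x).
Qed.

Let sconnected (u v : svertex) :
  connect [rel x y | [exists d, (stail d == x) && (stail (srev d) == y)]] u v.
Proof.
set e := [rel x y | _].
have step (d : sdart) : connect e (stail d) (stail (srev d)).
  by apply: connect1; apply/existsP; exists d; rewrite !eqxx.
have stepv d s t : kept d -> tail d = val s -> tail (srev_fun d) = val t ->
    connect e s t.
  move=> kd ds dt; have:= step (Sub d kd).
  have -> : stail (Sub d kd) = s by apply: val_inj.
  by have -> : stail (srev (Sub d kd)) = t by apply: val_inj; rewrite /= srevE.
(* Paths through [w] are redirected by treating [w] as [head a]. *)
pose skip t := if t == w then head a else t.
suff: forall t : svertex, val t = skip (val v) -> connect e u t.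
  by apply; rewrite /skip (negbTE (valP v)).
pose Q (x : vertex G) := forall t : svertex, val t = skip x -> connect e u t.
apply: (@connected_ind G Q (val u) (val v)); last first.
  move=> t; rewrite /skip (negbTE (valP u)) => E.
  by rewrite (val_inj E) connect0.
have hw : head a != w by apply: pg_loopless.
have hw' : head b != w by rewrite -tailb; apply: pg_loopless.
move=> d Hd t; rewrite /skip.
have [dw|ndw] := eqVneq (tail d) w.
  have ca : connect e u (Sub (head a) hw) by apply: Hd; rewrite /skip dw eqxx.
  move/eqP: dw; rewrite tail_w => /orP[]/eqP->.
    by rewrite (negbTE hw) => E; rewrite (val_inj (E : val t = val (Sub (head a) hw : svertex))).
  rewrite (negbTE hw') => E; apply: connect_trans ca _.
  apply: (stepv (rev G a)); rewrite ?tail_rev //.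
  by rewrite /srev_fun eqxx tail_rev.
have cs : connect e u (Sub (tail d) ndw) by apply: Hd; rewrite /skip (negbTE ndw).
have [hd|nhd] := eqVneq (head d) w => E.
  move: hd; rewrite -tail_rev => /eqP; rewrite tail_w.
  have R x y : (rev G x == y) = (x == rev G y).
    by rewrite -(inj_eq (@perm_inj _ (rev G))) revK.
  rewrite !R => /orP[]/eqP Ed.
    suff -> : t = Sub (tail d) ndw by [].
    by apply: val_inj; rewrite E /= Ed.
  apply: connect_trans cs _; apply: (stepv (rev G b)); rewrite /= ?Ed //.
  by rewrite /srev_fun eq_sym (negbTE raDrb) eqxx tail_rev E.
apply: connect_trans cs _; apply: (stepv d) => //; first by rewrite keptE.
rewrite /srev_fun E; case: eqP => [Ed|_].
  by rewrite Ed head_rev eqxx in nhd.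
case: eqP => [Ed|_] //.
by rewrite Ed head_rev tailb eqxx in nhd.
Qed.

Let sfaceE (x : sdart) : val ((srev * srot)%g x) =
  if kept (face G (val x)) then face G (val x)
  else face G (face G (val x)).
Proof.
rewrite permM srotE srevE /srev_fun.
have [->|nra] := eqVneq (val x) (rev G a).
  by rewrite face_ra /kept /= eqxx andbF faceE.
have [->|nrb] := eqVneq (val x) (rev G b).
  by rewrite face_rb /kept /= eqxx faceE.
rewrite ifT -?faceE // faceE; apply: kept_rot.
have R z y : (rev G z == y) = (z == rev G y).
  by rewrite -(inj_eq (@perm_inj _ (rev G))) revK.
by rewrite /kept /= !R nra nrb.
Qed.

Let kept_face d : ~~ kept d -> kept (face G d).
Proof.
rewrite negb_and !negbK => /orP[]/eqP->; rewrite keptE tail_face.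
  exact: pg_loopless.
by rewrite -tailb; apply: pg_loopless.
Qed.

Let card_sfaces : #|porbits (srev * srot)%g| = #|porbits (face G)|.
Proof. by apply: card_porbits_sub sfaceE kept_face. Qed.

Let card_svertex : #|svertex|.+1 = #|vertex G|.
Proof. by rewrite card_sig cardC1 prednK // (cardD1 w). Qed.

Let card_srev : #|porbits srev|.+1 = #|porbits (rev G)|.
Proof.
have e1 := card_porbits_involution (@revK G) (@revD G).
have sD (d : sdart) : srev d != d by apply: contra_neq (sloopless d) => ->.
have e2 := card_porbits_involution srevK sD.
have e3 : #|sdart|.+2 = #|dart G|.
  rewrite card_sig; have:= cardC [pred d | kept d].
  have -> : #|predC [pred d | kept d]| = 2.
    have <- : #|[set a; b]| = 2 by rewrite cards2 eq_sym bDa.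
    by apply: eq_card => d; rewrite !inE negb_and !negbK.
  by rewrite addn2.
lia.
Qed.

(** Vertices and edges both decrease by one, and the number of faces is unchanged. *)
Let seuler : #|svertex| + #|porbits (srev * srot)%g| = #|porbits srev| + 2.
Proof.
have := pg_euler G; rewrite -[(rev G * rot G)%g]/(face G) -card_svertex.
by rewrite -card_srev card_sfaces !addSn => -[].
Qed.

Definition suppress : plane_graph :=
  PlaneGraph souter srevK sloopless srotP sconnected seuler.

Lemma card_vertex_suppress : #|vertex suppress| < #|vertex G|.
Proof. by rewrite -card_svertex. Qed.

Lemma card_faces_suppress : #|faces suppress| = #|faces G|.
Proof. exact: card_sfaces. Qed.

Lemma suppress_porbit (x y : dart suppress) :
  (y \in porbit (face suppress) x) = (val y \in porbit (face G) (val x)).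
Proof. exact: (porbit_sub sfaceE). Qed.

Lemma suppress_simple_faces : simple_faces suppress.
Proof.
move=> x y; rewrite suppress_porbit => yx /(congr1 val) E.
by apply: val_inj; apply: sf.
Qed.

Lemma suppress_subdivision : edge_subdivision suppress G.
Proof.
exists (Sub (rev G a) kept_ra : sdart), (fun d : sdart => val d).
exists (fun v : svertex => val v), w, a, b; split.
- split=> [||||d]; first exact: val_inj.
  + by apply/codomP => -[d E]; have:= valP d; rewrite /kept /= -E eqxx.
  + by apply/codomP => -[d E]; have:= valP d; rewrite /kept /= -E eqxx andbF.
  + by rewrite eq_sym.
  + have [kd|] := boolP (kept d).
      by left; apply/codomP; exists (Sub d kd).
    by rewrite negb_and !negbK => /orP[]/eqP->; right; [left | right].
- split=> [||v]; first exact: val_inj.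
    by apply/codomP => -[v E]; have:= valP v; rewrite /= -E eqxx.
  have [->|nv] := eqVneq v w; first by right.
  by left; apply/codomP; exists (Sub v nv).
- by split.
- split=> [||d]; rewrite /= ?revK //.
    by rewrite srevE /srev_fun /= eqxx revK.
  rewrite -!val_eqE /= !srevE /srev_fun /= eqxx => nra nrb.
  by rewrite (negbTE nra) (negbTE nrb).
- by split=> // d; rewrite /= srotE.
Qed.

(** Arcs lift to [G], and so do unshared edges, even the merged one, because its two halves border
    the same faces. *)
Lemma suppress_pinched : pinched suppress -> pinched G.
Proof.
move=> [x1 [y1 [x2 [y2 [tf [p1 [q1 [p2 [q2 H]]]]]]]]].
have tfv : two_faces (val x1) (val y1) (val x2) (val y2).
  case: tf => Ex Ey D [o1 o2 o12]; split.
  - exact: (congr1 val Ex).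
  - exact: (congr1 val Ey).
  - by move: D; rewrite -val_eqE.
  - by rewrite -!suppress_porbit.
have [_ _ _ [o1 o2 _]] := tf.
have D1 := two_faces_neq tf; have D2 := two_faces_neq (two_faces_sym tf).
have lift (x y p z : dart suppress) : x != y -> y \in porbit (face suppress) x ->
    arc (face suppress) x y p /\ rev suppress p \notin porbit (face suppress) z ->
    arc (face G) (val x) (val y) (val p) /\
    rev G (val p) \notin porbit (face G) (val z).
  move=> xDy yo [ap np]; split; first exact: (arc_sub sfaceE).
  move: np; rewrite suppress_porbit /= srevE /srev_fun.
  have [->|nra] := eqVneq (val p) (rev G a).
    by rewrite revK -face_rb porbit_step.
  have [->|nrb] := eqVneq (val p) (rev G b); last by [].
  by rewrite revK -face_ra porbit_step.
have D1' : y1 != x1 by rewrite eq_sym.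
have D2' : y2 != x2 by rewrite eq_sym.
have o1' : x1 \in porbit (face suppress) y1 by rewrite porbit_sym.
have o2' : x2 \in porbit (face suppress) y2 by rewrite porbit_sym.
case: H => H1 H2 H3 H4.
exists (val x1), (val y1), (val x2), (val y2); split=> //.
exists (val p1), (val q1), (val p2), (val q2).
by split; apply: lift.
Qed.

End Suppress.

(** * Reduction to minimum degree 3 and conclusion *)

Lemma plane_iso_refl (G : plane_graph) : plane_iso G G.
Proof.
exists id, id; split; [by exists id | by exists id | by [] |].
by split=> //; split=> //; apply: porbit_id.
Qed.

(** Induction on the number of vertices: suppressing a vertex of degree 2 preserves simple faces and
    their number, and both outcomes carry back to [G]. *)
Lemma simple_faces_dichotomy (G : plane_graph) :
  simple_faces G -> 4 <= #|faces G| ->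
  pinched G \/
  exists H, [/\ simple_graph H, k_connected H 3 & is_subdivision H G].
Proof.
have [n] := ubnP #|vertex G|; elim: n G => // n IHn G le_n sf F4.
have [a /eqP rra|deg3] := pickP [pred a | rot G (rot G a) == a]; last first.
  have [|[simple conn3]] := @deg3_dichotomy G sf F4 (fun d => negbT (deg3 d)).
    by left.
  right; exists G; split=> //; apply: subdivision_iso; exact: plane_iso_refl.
have F3 : 2 < #|faces G| by apply: ltnW.
have [|||pin|[H [sH cH dH]]] := IHn (suppress sf F3 rra).
- by apply: leq_trans (card_vertex_suppress sf F3 rra) _.
- exact: suppress_simple_faces.
- by rewrite card_faces_suppress.
- by left; apply: suppress_pinched pin.
- right; exists H; split=> //; apply: subdivision_step dH _.
  exact: suppress_subdivision.
Qed.

Theorem theorem3 (G : plane_graph) :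
  k_connected G 2 ->
  4 <= #|faces G| ->
  (exists H : plane_graph,
     [/\ simple_graph H, k_connected H 3 & is_subdivision H G])
  \/
  (exists c : seq (dart G),
     separating_cycle c /\ size c <= max_face_degree G).
Proof.
move=> /k_connected2_simple_faces sf F4.
have [pin|sub] := simple_faces_dichotomy sf F4; last by left.
right; apply: pinched_separating_cycle pin => //.
exact: leq_trans F4.
Qed.
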